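(* Let $\lambda>0$. Suppose that $$\Psi(\mathbf{x})=\sum_{l=-\infty}^{\infty}\left(a_lP_l(\rho)+b_l(\lambda\rho)^{|l|}\right)e^{il\theta},$$ where $(\rho,\theta)$ are the polar coordinates of $\mathbf{x}$ with respect to the origin, is a local expansion (with complex coefficients $a_l,b_l$) for a parent box centered at the origin. Let $(\rho_0,\theta_0)$ be the polar coordinates of the center $\mathbf{x}_0$ of a child box with respect to the origin. Then, for $\mathbf{x}$ inside the child box, we have $$\Psi(\mathbf{x})=\sum_{l=-\infty}^{\infty}\left(c_lP_l(\rho')+d_l(\lambda\rho')^{|l|}\right)e^{il\theta'},$$ where $(\rho',\theta')$ are the polar coordinates of $\mathbf{x}$ with respect to the child's center $\mathbf{x}_0$, and the coefficients are as follows. For all $l$, $$c_l=\sum_{m=-\infty}^{\infty}a_mI_{l-m}(\lambda\rho_0)e^{-i(l-m)\theta_0}.$$ For $l>0$, $$d_l=\frac{1}{2^l\,l!}\sum_{m=-\infty}^{l-1}a_mI_{l-m}(\lambda\rho_0)e^{-i(l-m)\theta_0}+\frac{1}{2^l\,l!}\sum_{m=l}^{\infty}a_mP_{l-m}(\rho_0)e^{-i(l-m)\theta_0}+\sum_{m=l}^{\infty}\binom{m}{l}b_m(\lambda\rho_0)^{|l-m|}e^{-i(l-m)\theta_0}.$$ For $l=0$, $$d_0=\sum_{m=-\infty}^{\infty}a_mP_{-m}(\rho_0)e^{im\theta_0}+\sum_{m=-\infty}^{\infty}b_m(\lambda\rho_0)^{|m|}e^{im\theta_0}.$$ For $l<0$,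 $$d_l=\frac{1}{2^{|l|}|l|!}\sum_{m=-\infty}^{l}a_mP_{l-m}(\rho_0)e^{-i(l-m)\theta_0}+\frac{1}{2^{|l|}|l|!}\sum_{m=l+1}^{\infty}a_mI_{l-m}(\lambda\rho_0)e^{-i(l-m)\theta_0}+\sum_{m=-\infty}^{l}\binom{|m|}{|l|}b_m(\lambda\rho_0)^{|l-m|}e^{-i(l-m)\theta_0}.$$
   Context: $I_n$ ($n\in\mathbb{Z}$) is the modified Bessel function of the first kind, with $I_{-n}=I_n$. For $r\ge 0$, $n\in\mathbb{Z}$, define $$P_n(r)=I_n(\lambda r)-\left(\frac{\lambda r}{2}\right)^{|n|}\frac{1}{|n|!}.$$ Note that the factor $\lambda$ is already included in the definition of $P_n$. The convention $0^0=1$ is used. The polar coordinates of $\mathbf{x}\in\mathbb{R}^2$ with respect to the origin are given by $\mathbf{x}=\rho(\cos\theta,\sin\theta)$, and those with respect to $\mathbf{x}_0$ by $\mathbf{x}-\mathbf{x}_0=\rho'(\cos\theta',\sin\theta')$. A box is an axis-aligned square in $\mathbb{R}^2$. A child box is any of the four boxes resulting from dividing a parent box into equal square quadrants. A local expansion for a box centered at the origin is a series of the displayed form which converges absolutely to the function $\Psi$ (a solution of the modified biharmonic equation $\Delta(\Delta-\lambda^2)\Psi=0$) at every point inside the box. ''Inside'' a box refers to its interior. *)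

(* Defs.v *)
From Stdlib Require Import Reals ZArith.
From Coquelicot Require Import Coquelicot.

Open Scope R_scope.

(** An infinite sum of complex numbers is understood as an absolutely
    convergent one: the [is_sum] predicates assert both the absolute convergence and the value. *)

Definition is_abs_series (u : nat -> C) (s : C) : Prop :=
  ex_series (fun k => Cmod (u k)) /\
  @is_series R_AbsRing C_R_NormedModule u s.

Definition is_sum_ge (l : Z) (u : Z -> C) (s : C) : Prop :=
  is_abs_series (fun k => u (l + Z.of_nat k)%Z) s.

Definition is_sum_le (l : Z) (u : Z -> C) (s : C) : Prop :=
  is_abs_series (fun k => u (l - Z.of_nat k)%Z) s.

Definition is_sum_Z (u : Z -> C) (s : C) : Prop :=
  exists s1 s2 : C,
    is_sum_le (-1) u s1 /\ is_sum_ge 0 u s2 /\ s = Cplus s1 s2.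

(** Modified Bessel function of the first kind of integer order; the power
    series depends on [n] only through [|n|], so that I_{-n} = I_n. *)
Definition besselI (n : Z) (x : R) : R :=
  Series (fun k : nat =>
    (x / 2) ^ (2 * k + Z.abs_nat n)
      / (INR (fact k) * INR (fact (k + Z.abs_nat n)))).

(** [pow] satisfies [0 ^ 0 = 1]. *)
Definition besselP (lambda : R) (n : Z) (r : R) : R :=
  besselI n (lambda * r)
    - (lambda * r / 2) ^ Z.abs_nat n / INR (fact (Z.abs_nat n)).

(** e^{i t} *)
Definition expi (t : R) : C := (cos t, sin t).

Definition is_polar (v : R * R) (rho theta : R) : Prop :=
  0 <= rho /\ fst v = rho * cos theta /\ snd v = rho * sin theta.

Definition vsub (x y : R * R) : R * R := (fst x - fst y, snd x - snd y).

Record box : Type := Box {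
  center : R * R;
  side : R;
  side_pos : 0 < side
}.

Definition inside (B : box) (x : R * R) : Prop :=
  Rabs (fst x - fst (center B)) < side B / 2 /\
  Rabs (snd x - snd (center B)) < side B / 2.

(** [Q] is one of the four quadrants of [B]. *)
Definition child_box (B Q : box) : Prop :=
  side Q = side B / 2 /\
  Rabs (fst (center Q) - fst (center B)) = side B / 4 /\
  Rabs (snd (center Q) - snd (center B)) = side B / 4.

(** On [D], the function [f] has first and pure second partial derivatives,
    and [g] is its Laplacian.  Continuity of the partial derivatives is not
    asked for. *)
Definition is_laplacian (D : R * R -> Prop) (f g : R * R -> C) : Prop :=
  exists fx fy fxx fyy : R * R -> C,
    forall x y : R, D (x, y) ->
      @is_derive R_AbsRing C_R_NormedModule (fun t => f (t, y)) x (fx (x, y)) /\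
      @is_derive R_AbsRing C_R_NormedModule (fun t => f (x, t)) y (fy (x, y)) /\
      @is_derive R_AbsRing C_R_NormedModule (fun t => fx (t, y)) x (fxx (x, y)) /\
      @is_derive R_AbsRing C_R_NormedModule (fun t => fy (x, t)) y (fyy (x, y)) /\
      g (x, y) = Cplus (fxx (x, y)) (fyy (x, y)).

(** Delta (Delta - lambda^2) f = 0 on [D], read as Delta h = 0 with
    h = Delta f - lambda^2 f. *)
Definition modified_biharmonic (lambda : R) (D : R * R -> Prop)
    (f : R * R -> C) : Prop :=
  exists g : R * R -> C,
    is_laplacian D f g /\
    is_laplacian D (fun x => Cminus (g x) (Cmult (RtoC (lambda ^ 2)) (f x)))
      (fun _ => RtoC 0).

Definition expansion_term (lambda : R) (a b : Z -> C) (rho theta : R) (l : Z)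
    : C :=
  Cmult
    (Cplus (Cmult (a l) (RtoC (besselP lambda l rho)))
           (Cmult (b l) (RtoC ((lambda * rho) ^ Z.abs_nat l))))
    (expi (IZR l * theta)).

(** The expansion about the center of [B] with coefficients [a], [b] converges
    absolutely to [Psi] inside [B].  At the center itself the angle is
    arbitrary. *)
Definition expands (lambda : R) (a b : Z -> C) (B : box) (Psi : R * R -> C)
    : Prop :=
  forall x : R * R, inside B x ->
  forall rho theta : R, is_polar (vsub x (center B)) rho theta ->
    is_sum_Z (expansion_term lambda a b rho theta) (Psi x).

Definition local_expansion (lambda : R) (a b : Z -> C) (B : box)
    (Psi : R * R -> C) : Prop :=
  modified_biharmonic lambda (inside B) Psi /\ expands lambda a b B Psi.

Definition aI_term (lambda : R) (a : Z -> C) (rho0 theta0 : R) (l m : Z) : C :=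
  Cmult (Cmult (a m) (RtoC (besselI (l - m) (lambda * rho0))))
        (expi (- (IZR (l - m) * theta0))).

Definition aP_term (lambda : R) (a : Z -> C) (rho0 theta0 : R) (l m : Z) : C :=
  Cmult (Cmult (a m) (RtoC (besselP lambda (l - m) rho0)))
        (expi (- (IZR (l - m) * theta0))).

(** Only used for [|l| <= |m|], where [Binomial.C] is the binomial
    coefficient. *)
Definition b_term (lambda : R) (b : Z -> C) (rho0 theta0 : R) (l m : Z) : C :=
  Cmult
    (Cmult (Cmult (RtoC (Binomial.C (Z.abs_nat m) (Z.abs_nat l))) (b m))
           (RtoC ((lambda * rho0) ^ Z.abs_nat (l - m))))
    (expi (- (IZR (l - m) * theta0))).

Definition is_coef_c (lambda : R) (a : Z -> C) (rho0 theta0 : R) (l : Z)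
    (cl : C) : Prop :=
  is_sum_Z (aI_term lambda a rho0 theta0 l) cl.

Definition inv_2fact (l : Z) : C :=
  RtoC (/ (2 ^ Z.abs_nat l * INR (fact (Z.abs_nat l)))).

Definition is_coef_d_pos (lambda : R) (a b : Z -> C) (rho0 theta0 : R) (l : Z)
    (dl : C) : Prop :=
  exists s1 s2 s3 : C,
    is_sum_le (l - 1) (aI_term lambda a rho0 theta0 l) s1 /\
    is_sum_ge l (aP_term lambda a rho0 theta0 l) s2 /\
    is_sum_ge l (b_term lambda b rho0 theta0 l) s3 /\
    dl = Cplus (Cplus (Cmult (inv_2fact l) s1) (Cmult (inv_2fact l) s2)) s3.

Definition is_coef_d_zero (lambda : R) (a b : Z -> C) (rho0 theta0 : R)
    (d0 : C) : Prop :=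
  exists s1 s2 : C,
    is_sum_Z (fun m => Cmult (Cmult (a m) (RtoC (besselP lambda (- m) rho0)))
                             (expi (IZR m * theta0))) s1 /\
    is_sum_Z (fun m => Cmult (Cmult (b m) (RtoC ((lambda * rho0) ^ Z.abs_nat m)))
                             (expi (IZR m * theta0))) s2 /\
    d0 = Cplus s1 s2.

Definition is_coef_d_neg (lambda : R) (a b : Z -> C) (rho0 theta0 : R) (l : Z)
    (dl : C) : Prop :=
  exists s1 s2 s3 : C,
    is_sum_le l (aP_term lambda a rho0 theta0 l) s1 /\
    is_sum_ge (l + 1) (aI_term lambda a rho0 theta0 l) s2 /\
    is_sum_le l (b_term lambda b rho0 theta0 l) s3 /\
    dl = Cplus (Cplus (Cmult (inv_2fact l) s1) (Cmult (inv_2fact l) s2)) s3.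

(* Main.v *)
Require Import Defs.
From Stdlib Require Import Reals ZArith List Permutation Lra Lia Classical.
From Coquelicot Require Import Coquelicot.
Import ListNotations.

Open Scope R_scope.

(** The idea is to trade the expansion in angular modes for a power series in
    two variables, where a change of centre is nothing but the binomial
    theorem. Put [z = (lambda / 2) (x1 + i x2)]. Both [I_m(lambda rho) e^{i m
    theta}] and [(lambda rho)^|m| e^{i m theta}] are combinations of the
    monomials [z^p/p! * conj(z)^q/q!] on the diagonal [p - q = m]: the former
    is the sum of all of them ([mono_polar]), the latter is [2^|m| |m|!] times
    the one with [min(p, q) = 0], and [P_m] leaves out exactly that one. So an
    expansion with coefficients [a], [b] is the double series

      [sum_{p,q} K(p,q) z^p/p! conj(z)^q/q!]

    in which [K(p,q)] is [a_{p-q}] for [p, q >= 1], and [2^|m| |m|! b_m] with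
    [m = p - q] when [min(p, q) = 0] ([power_coef],
    [expansion_of_power_series]).

    For [z = w + v], with [w] the new centre, the binomial theorem turns this
    series into the one in [v] with coefficients

      [K'(j,t) = sum_{i,s} K(i+j,s+t) w^i/i! conj(w)^s/s!]

    ([recenter_expand]). When [j, t >= 1], only values [a_{(i+j)-(s+t)}] occur
    in it, so that [K'(j,t)] depends on [j - t] alone; hence [K'] comes from
    coefficients [c], [d] in the same way as [K] comes from [a], [b]
    ([recenter_power_coef]). Summing the series for [K'] along the diagonals
    [i - s = m - l] gives the stated formulas ([new_c_correct],
    [new_d_split]): the inner sum is [a_m I_{l-m}], or [a_m P_{l-m}] plus a
    multiple of [b_m] when the diagonal, shifted by [(j,t)], begins on the
    boundary of the quadrant. That is the case distinction between [m] and [l].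

    The rearrangements need absolute convergence of the double series at
    [|w| + |v|]. The hypothesis bounds only [a_m P_m(r) + b_m (lambda r)^|m|],
    for every [r] smaller than the distance from the centre to a corner.
    Comparing two radii eliminates [b_m] and bounds [a_m], and then [b_m], well
    enough for the double series to converge absolutely at all these radii
    ([a_summable], [b_summable], [summable_at_power_coef]). The centre of the
    child is halfway to a corner of the parent, and a point inside the child is
    closer to it than that, so [|w| + |v|] stays in this range.

    Infinite sums are handled as unordered sums over arbitrary index types;
    [usum_prod] (Fubini), [sum_le_prod] (Tonelli) and [usum_inj] (change of
    index) justify all rearrangements. *)

(** * Finite sums *)

Definition fsum {I : Type} {G : AbelianMonoid} (f : I -> G) (L : list I) : G :=
  fold_right (fun i s => plus (f i) s) zero L.

Lemma minus_plus_l {G : AbelianGroup} (x y : G) : minus (plus x y) x = y.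
Proof.
  unfold minus.
  rewrite (plus_comm x), <- plus_assoc.
  etransitivity; [|apply plus_zero_r]. apply f_equal, plus_opp_r.
Qed.

Lemma fsum_ext {I : Type} {G : AbelianMonoid} (f g : I -> G) (L : list I) :
  (forall i, In i L -> f i = g i) -> fsum f L = fsum g L.
Proof.
  induction L as [|i L IH]; simpl; intros H; [reflexivity|].
  rewrite H by auto. now rewrite IH by auto.
Qed.

Lemma fsum_app {I : Type} {G : AbelianMonoid} (f : I -> G) (L M : list I) :
  fsum f (L ++ M) = plus (fsum f L) (fsum f M).
Proof.
  induction L as [|i L IH]; simpl; [now rewrite plus_zero_l|].
  now rewrite IH, plus_assoc.
Qed.

Lemma fsum_map {I J : Type} {G : AbelianMonoid} (f : J -> G) (phi : I -> J)
    (L : list I) :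
  fsum f (map phi L) = fsum (fun i => f (phi i)) L.
Proof. induction L as [|i L IH]; simpl; congruence. Qed.

Lemma fsum_zero {I : Type} {G : AbelianMonoid} (f : I -> G) (L : list I) :
  (forall i, In i L -> f i = zero) -> fsum f L = zero.
Proof.
  induction L as [|i L IH]; simpl; intros H; [reflexivity|].
  rewrite H by auto. rewrite IH by auto. apply plus_zero_l.
Qed.

Lemma fsum_perm {I : Type} {G : AbelianMonoid} (f : I -> G) (L M : list I) :
  Permutation L M -> fsum f L = fsum f M.
Proof.
  induction 1; simpl; try congruence.
  now rewrite !plus_assoc, (plus_comm (f y)).
Qed.

Lemma fsum_plus {I : Type} {G : AbelianMonoid} (f g : I -> G) (L : list I) :
  fsum (fun i => plus (f i) (g i)) L = plus (fsum f L) (fsum g L).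
Proof.
  induction L as [|i L IH]; simpl; [now rewrite plus_zero_l|].
  rewrite IH, <- !plus_assoc. f_equal.
  now rewrite !plus_assoc, (plus_comm (g i)).
Qed.

Lemma fsum_prod {I J : Type} {G : AbelianMonoid} (f : I * J -> G)
    (A : list I) (B : list J) :
  fsum f (list_prod A B) = fsum (fun i => fsum (fun j => f (i, j)) B) A.
Proof.
  induction A as [|i A IH]; simpl; [reflexivity|].
  now rewrite fsum_app, fsum_map, IH.
Qed.

Lemma fsum_le {I : Type} (f g : I -> R) (L : list I) :
  (forall i, In i L -> f i <= g i) -> fsum f L <= fsum g L.
Proof.
  induction L as [|i L IH]; simpl; intros H; [apply Rle_refl|].
  apply Rplus_le_compat; auto.
Qed.

Lemma fsum_ge0 {I : Type} (f : I -> R) (L : list I) :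
  (forall i, 0 <= f i) -> 0 <= fsum f L.
Proof.
  intros H. induction L as [|i L IH]; simpl; [apply Rle_refl|].
  now apply Rplus_le_le_0_compat.
Qed.

Lemma fsum_scal {I : Type} (c : R) (f : I -> R) (L : list I) :
  fsum (fun i => c * f i) L = c * fsum f L.
Proof.
  induction L as [|i L IH]; simpl.
  - symmetry; apply Rmult_0_r.
  - rewrite IH. symmetry. apply Rmult_plus_distr_l.
Qed.

Lemma norm_fsum {I : Type} {V : NormedModule R_AbsRing} (f : I -> V)
    (L : list I) :
  norm (fsum f L) <= fsum (fun i => norm (f i)) L.
Proof.
  induction L as [|i L IH]; simpl.
  - rewrite norm_zero. apply Rle_refl.
  - eapply Rle_trans; [apply norm_triangle|]. now apply Rplus_le_compat_l.
Qed.

Lemma fsum_sum_n {G : AbelianMonoid} (f : nat -> G) (n : nat) :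
  fsum f (seq 0 (S n)) = sum_n f n.
Proof.
  induction n as [|n IH].
  - simpl. now rewrite sum_O, plus_zero_r.
  - rewrite seq_S, fsum_app, IH, sum_Sn. simpl. now rewrite plus_zero_r.
Qed.

(** Excluded middle replaces decidable equality here and in the two lemmas
    below, so that index types need no structure at all. *)
Lemma nodup_same_elements {I : Type} (L : list I) :
  exists M, NoDup M /\ (forall i, In i M <-> In i L).
Proof.
  induction L as [|i L [M [HM HI]]].
  - exists nil. split; [constructor|tauto].
  - destruct (classic (In i M)) as [Hi|Hi].
    + exists M. split; [assumption|]. intros j. rewrite HI. simpl.
      split; [auto|]. intros [<-|Hj]; [now apply HI|assumption].
    + exists (i :: M). split; [now constructor|].
      intros j. simpl. now rewrite HI.
Qed.

Lemma permutation_partition {I : Type} (P : I -> Prop) (L : list I) :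
  exists M1 M2, Permutation L (M1 ++ M2) /\
    (forall i, In i M1 -> P i) /\ (forall i, In i M2 -> ~ P i).
Proof.
  induction L as [|i L (M1 & M2 & HP & H1 & H2)].
  - exists nil, nil. repeat split; auto; contradiction.
  - destruct (classic (P i)) as [Hi|Hi].
    + exists (i :: M1), M2. split; [now constructor|].
      split; [|assumption]. intros j [<-|Hj]; auto.
    + exists M1, (i :: M2). split; [now apply Permutation_cons_app|].
      split; [assumption|]. intros j [<-|Hj]; auto.
Qed.

Lemma nodup_split {I : Type} (L M : list I) :
  NoDup L -> NoDup M -> incl L M ->
  exists N, Permutation M (L ++ N) /\ (forall i, In i N -> ~ In i L).
Proof.
  intros HL HM Hi.
  destruct (permutation_partition (fun i => In i L) M) as (M1 & M2 & HP & H1 & H2).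
  exists M2. split; [|assumption].
  rewrite HP. apply Permutation_app_tail.
  assert (HN : NoDup (M1 ++ M2)) by (eapply Permutation_NoDup; eauto).
  apply NoDup_Permutation.
  - now apply NoDup_app_remove_r in HN.
  - assumption.
  - intros i. split; [apply H1|]. intros Hin.
    assert (H : In i (M1 ++ M2)) by (eapply Permutation_in; [eauto|auto]).
    apply in_app_or in H as [H|H]; [assumption|]. now apply H2 in H.
Qed.

Lemma NoDup_list_prod {I J : Type} (A : list I) (B : list J) :
  NoDup A -> NoDup B -> NoDup (list_prod A B).
Proof.
  intros HA HB. induction HA as [|i A Hi HA IH]; simpl; [constructor|].
  apply NoDup_app; [|assumption|].
  - apply FinFun.Injective_map_NoDup; [|assumption].
    intros j j' [= Hj]. exact Hj.
  - intros [i' j] H H'. apply in_map_iff in H as (j' & [= <- <-] & _).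
    apply in_prod_iff in H' as [H' _]. contradiction.
Qed.

(** * Unordered summation *)

(** The filter of finite subsets of [I] directed by inclusion, a finite subset
    being encoded by a list without repetition. *)
Definition finsets (I : Type) (P : list I -> Prop) : Prop :=
  exists L0, forall L, NoDup L -> incl L0 L -> P L.

Global Instance finsets_filter (I : Type) : ProperFilter (finsets I).
Proof.
  split.
  - intros P [L0 H]. destruct (nodup_same_elements L0) as [M [HM HI]].
    exists M. apply H; [assumption|]. intros i. apply HI.
  - split.
    + exists nil. trivial.
    + intros P Q [L0 HP] [L1 HQ]. exists (L0 ++ L1). intros L HL Hi.
      apply incl_app_inv in Hi as []. auto.
    + intros P Q H [L0 HP]. exists L0. auto.
Qed.

(** Unordered summation: the limit of the finite partial sums along the
    directed set of finite subsets. It ignores any enumeration of [I], which is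
    what makes reindexing and the interchange of sums painless. *)
Definition usum {I : Type} {V : NormedModule R_AbsRing} (f : I -> V)
    (s : V) : Prop :=
  filterlim (fsum f) (finsets I) (locally s).

(** For a nonnegative [g] this is the inequality between the sum of [g] in
    [[0, +oo]] and [M]; absolute summability is expressed through it. *)
Definition sum_le {I : Type} (g : I -> R) (M : R) : Prop :=
  forall L, NoDup L -> fsum g L <= M.

Section Unordered.

Context {V : NormedModule R_AbsRing}.

Lemma usum_norm {I : Type} (f : I -> V) (s : V) :
  usum f s <-> forall eps : posreal,
    finsets I (fun L => norm (minus (fsum f L) s) < eps).
Proof. exact (@filterlim_locally_ball_norm R_AbsRing (list I) V (finsets I) _ (fsum f) s). Qed.

Lemma usum_unique {I : Type} (f : I -> V) (s t : V) :
  usum f s -> usum f t -> s = t.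
Proof. apply filterlim_locally_unique. Qed.

Lemma usum_ext {I : Type} (f g : I -> V) (s : V) :
  (forall i, f i = g i) -> usum f s -> usum g s.
Proof.
  intros H. apply filterlim_ext. intros L. apply fsum_ext. auto.
Qed.

Lemma sum_le_ge0 {I : Type} (g : I -> R) (M : R) : sum_le g M -> 0 <= M.
Proof. intros H. apply (H nil). constructor. Qed.

Lemma sum_le_weaken {I : Type} (g h : I -> R) (M : R) :
  (forall i, h i <= g i) -> sum_le g M -> sum_le h M.
Proof.
  intros H HM L HL. apply Rle_trans with (fsum g L); [|now apply HM].
  apply fsum_le. auto.
Qed.

Lemma sum_le_term {I : Type} (g : I -> R) (M : R) (i : I) :
  sum_le g M -> g i <= M.
Proof.
  intros H. replace (g i) with (fsum g [i]).
  - apply H. constructor; [intros []|constructor].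
  - simpl. apply (plus_zero_r (G := R_AbelianMonoid)).
Qed.

Lemma sum_le_scal {I : Type} (c : R) (g : I -> R) (M : R) :
  0 <= c -> sum_le g M -> sum_le (fun i => c * g i) (c * M).
Proof.
  intros Hc H L HL. rewrite fsum_scal. now apply Rmult_le_compat_l, H.
Qed.

Lemma sum_le_plus {I : Type} (g h : I -> R) (M N : R) :
  sum_le g M -> sum_le h N -> sum_le (fun i => g i + h i) (M + N).
Proof.
  intros HM HN L HL. eapply Rle_trans.
  - apply Req_le. exact (fsum_plus (G := R_AbelianMonoid) g h L).
  - apply Rplus_le_compat; auto.
Qed.

Lemma sum_le_inj {I J : Type} (phi : I -> J) (g : J -> R) (M : R) :
  (forall i i', phi i = phi i' -> i = i') ->
  sum_le g M -> sum_le (fun i => g (phi i)) M.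
Proof.
  intros Hphi H L HL. rewrite <- fsum_map. apply H.
  apply FinFun.Injective_map_NoDup; assumption.
Qed.

(** Tonelli's theorem as an inequality: a finite set of pairs lies in a finite
    rectangle, where the partial sum can be computed row by row. *)
Lemma sum_le_prod {I J : Type} (g : I * J -> R) (B : I -> R) (M : R) :
  (forall x, 0 <= g x) ->
  (forall i, sum_le (fun j => g (i, j)) (B i)) -> sum_le B M -> sum_le g M.
Proof.
  intros H0 HB HM L HL.
  destruct (nodup_same_elements (map fst L)) as [A [HA HA']].
  destruct (nodup_same_elements (map snd L)) as [D [HD HD']].
  assert (Hincl : incl L (list_prod A D)).
  { intros [i j] Hij. apply in_prod.
    - apply HA'. change i with (fst (i, j)). now apply in_map.
    - apply HD'. change j with (snd (i, j)). now apply in_map. }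
  destruct (nodup_split L (list_prod A D)) as [N [HP _]]; auto.
  { now apply NoDup_list_prod. }
  apply Rle_trans with (fsum g (list_prod A D)).
  - rewrite (fsum_perm _ _ _ HP), fsum_app.
    rewrite <- (Rplus_0_r (fsum g L)) at 1.
    apply Rplus_le_compat_l, fsum_ge0, H0.
  - rewrite fsum_prod. eapply Rle_trans; [|apply (HM A HA)].
    apply fsum_le. intros i _. now apply HB.
Qed.

Lemma sum_le_finite {I : Type} (g : I -> R) (L0 : list I) :
  NoDup L0 -> (forall i, 0 <= g i) -> (forall i, ~ In i L0 -> g i = 0) ->
  sum_le g (fsum g L0).
Proof.
  intros HL0 H0 Hz L HL.
  destruct (permutation_partition (fun i => In i L0) L) as (M1 & M2 & HP & H1 & H2).
  rewrite (fsum_perm _ _ _ HP), fsum_app, (fsum_zero g M2) by auto.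
  rewrite plus_zero_r.
  assert (HN : NoDup M1).
  { eapply NoDup_app_remove_r, Permutation_NoDup; eauto. }
  destruct (nodup_split M1 L0) as [N [HP' _]]; auto.
  rewrite (fsum_perm _ _ _ HP'), fsum_app.
  rewrite <- (Rplus_0_r (fsum g M1)) at 1.
  apply Rplus_le_compat_l, fsum_ge0, H0.
Qed.

Lemma usum_finite {I : Type} (f : I -> V) (L0 : list I) :
  NoDup L0 -> (forall i, ~ In i L0 -> f i = zero) -> usum f (fsum f L0).
Proof.
  intros HL0 Hz. apply usum_norm. intros eps. exists L0. intros L HL Hi.
  destruct (nodup_split L0 L) as [N [HP HN]]; auto.
  rewrite (fsum_perm _ _ _ HP), fsum_app, (fsum_zero f N) by auto.
  rewrite plus_zero_r, minus_eq_zero. apply Rle_lt_trans with 0; [|apply cond_pos].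
  apply Req_le. exact (@norm_zero R_AbsRing V).
Qed.

(** Change of index along an injection. Once a finite set contains the
    preimage of [L0], enlarging its image by the rest of [L0] only adds terms
    outside the range of [phi], which vanish. *)
Lemma usum_inj {I J : Type} (phi : I -> J) (f : J -> V) (s : V) :
  (forall i i', phi i = phi i' -> i = i') ->
  (forall j, (forall i, phi i <> j) -> f j = zero) ->
  usum f s -> usum (fun i => f (phi i)) s.
Proof.
  intros Hphi Hz Hs. apply usum_norm. intros eps.
  destruct (proj1 (usum_norm _ _) Hs eps) as [L0 H].
  assert (Hpre : exists K, forall i, In (phi i) L0 -> In i K).
  { clear H. induction L0 as [|j L0 [K HK]].
    - exists nil. auto.
    - destruct (classic (exists i, phi i = j)) as [[i <-]|Hn].
      + exists (i :: K). intros i' [Hi|Hi]; [left; auto|right; auto].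
      + exists K. intros i' [Hi|Hi]; [|auto]. exfalso. eauto. }
  destruct Hpre as [K HK]. exists K. intros L HL Hi.
  rewrite <- fsum_map.
  assert (HmL : NoDup (map phi L)) by (apply FinFun.Injective_map_NoDup; assumption).
  destruct (nodup_same_elements (map phi L ++ L0)) as [M [HM HM']].
  destruct (nodup_split (map phi L) M) as [N [HP HN]]; auto.
  { intros j Hj. apply HM', in_or_app. now left. }
  replace (fsum f (map phi L)) with (fsum f M).
  - apply H; [assumption|]. intros j Hj. apply HM', in_or_app. now right.
  - rewrite (fsum_perm _ _ _ HP), fsum_app, (fsum_zero f N).
    + apply plus_zero_r.
    + intros j Hj. apply Hz. intros i <-. apply (HN _ Hj).
      apply in_map, Hi, HK.
      assert (HjM : In (phi i) M).
      { eapply Permutation_in; [symmetry; exact HP|]. apply in_or_app. now right. }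
      apply HM', in_app_or in HjM as [HjM|HjM]; [|assumption].
      exfalso. now apply (HN _ Hj).
Qed.

Lemma usum_fsum {I J : Type} (f : I -> J -> V) (g : I -> V) (A : list I) :
  (forall i, usum (f i) (g i)) ->
  usum (fun j => fsum (fun i => f i j) A) (fsum g A).
Proof.
  intros H. induction A as [|i A IH].
  - apply filterlim_ext with (fun _ => zero).
    + intros L. symmetry. now apply fsum_zero.
    + apply filterlim_const.
  - apply filterlim_ext with
      (fun L => plus (fsum (f i) L) (fsum (fun j => fsum (fun i => f i j) A) L)).
    + intros L. symmetry. apply (fsum_plus (f i)).
    + eapply filterlim_comp_2; [apply H|apply IH|]. apply @filterlim_plus.
Qed.

(** Fubini's theorem. For a fixed finite set [A] of rows, the sums over
    rectangles with base [A] converge to the sum of [g] over [A], and a large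
    rectangle also sums to nearly [s]. *)
Lemma usum_prod {I J : Type} (f : I * J -> V) (g : I -> V) (s : V) :
  usum f s -> (forall i, usum (fun j => f (i, j)) (g i)) -> usum g s.
Proof.
  intros Hf Hg. apply usum_norm. intros eps.
  destruct (proj1 (usum_norm _ _) Hf (pos_div_2 eps)) as [L0 HL0].
  exists (map fst L0). intros A HA HiA.
  pose proof (usum_fsum (fun i j => f (i, j)) g A Hg) as HfA.
  pose proof (proj1 (usum_norm _ _) HfA (pos_div_2 eps)) as HfE.
  assert (HB : finsets J (fun B => NoDup B /\ incl (map snd L0) B)).
  { exists (map snd L0). auto. }
  destruct (filter_ex _ (filter_and _ _ HfE HB)) as (B & H1 & HBn & HBi).
  assert (Hsum : fsum (fun j => fsum (fun i => f (i, j)) A) B =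
                 fsum f (list_prod A B)).
  { rewrite fsum_prod. clear. induction A as [|i A IH]; simpl.
    - now apply fsum_zero.
    - rewrite <- IH. apply (fsum_plus (fun j => f (i, j))). }
  assert (H2 : norm (minus (fsum f (list_prod A B)) s) < pos_div_2 eps).
  { apply HL0; [now apply NoDup_list_prod|].
    intros [i j] Hij. apply in_prod.
    - apply HiA. change i with (fst (i, j)). now apply in_map.
    - apply HBi. change j with (snd (i, j)). now apply in_map. }
  rewrite (minus_trans (fsum f (list_prod A B))).
  eapply Rle_lt_trans; [apply norm_triangle|].
  rewrite <- (norm_opp (minus (fsum g A) _)), opp_minus, <- Hsum.
  rewrite <- Hsum in H2. simpl in H1, H2. lra.
Qed.

(** The row sums of an absolutely summable family are absolutely summable: the
    triangle inequality on finite rectangles passes to the limit. *)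
Lemma sum_le_usum_prod {I J : Type} (f : I * J -> V) (g : I -> V) (M : R) :
  sum_le (fun x => norm (f x)) M ->
  (forall i, usum (fun j => f (i, j)) (g i)) ->
  sum_le (fun i => norm (g i)) M.
Proof.
  intros HM Hg A HA.
  apply (filterlim_le (F := finsets J)
    (fun B => fsum (fun i => norm (fsum (fun j => f (i, j)) B)) A) (fun _ => M)
    (fsum (fun i => norm (g i)) A) M).
  - exists nil. intros B HB _.
    apply Rle_trans with (fsum (fun x => norm (f x)) (list_prod A B)).
    + rewrite fsum_prod. apply fsum_le. intros i _. apply norm_fsum.
    + apply HM. now apply NoDup_list_prod.
  - clear HA. induction A as [|i A IH]; simpl; [apply filterlim_const|].
    eapply filterlim_comp_2; [|exact IH|apply (filterlim_plus (V := R_NormedModule))].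
    eapply filterlim_comp; [apply Hg|apply filterlim_norm].
  - apply filterlim_const.
Qed.

Lemma usum_is_series (f : nat -> V) (s : V) : usum f s -> is_series f s.
Proof.
  intros H. unfold is_series.
  apply filterlim_ext with (fun n => fsum f (seq 0 (S n))).
  { intros n. apply fsum_sum_n. }
  eapply filterlim_comp; [|exact H].
  intros P [L0 HP]. exists (list_max L0). intros n Hn. apply HP.
  - apply seq_NoDup.
  - intros k Hk. apply in_seq. split; [lia|].
    assert (k <= list_max L0)%nat; [|lia].
    pose proof (proj1 (list_max_le L0 _) (le_n _)) as Hf.
    rewrite Forall_forall in Hf. auto.
Qed.

Lemma usum_map {W : NormedModule R_AbsRing} {I : Type} (phi : V -> W)
    (f : I -> V) (s : V) :
  phi zero = zero -> (forall x y, phi (plus x y) = plus (phi x) (phi y)) ->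
  filterlim phi (locally s) (locally (phi s)) ->
  usum f s -> usum (fun i => phi (f i)) (phi s).
Proof.
  intros H0 Hp Hc Hs.
  apply filterlim_ext with (fun L => phi (fsum f L)).
  - intros L. induction L as [|i L IH]; simpl; [assumption|].
    now rewrite Hp, IH.
  - eapply filterlim_comp; eassumption.
Qed.

Lemma usum_plus {I : Type} (f g : I -> V) (s t : V) :
  usum f s -> usum g t -> usum (fun i => plus (f i) (g i)) (plus s t).
Proof.
  intros Hf Hg.
  apply filterlim_ext with (fun L => plus (fsum f L) (fsum g L)).
  - intros L. symmetry. apply fsum_plus.
  - eapply filterlim_comp_2; [apply Hf|apply Hg|]. apply @filterlim_plus.
Qed.

Lemma norm_fsum_tail {I : Type} (f : I -> V) (L0 L : list I) :
  NoDup L0 -> NoDup L -> incl L0 L ->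
  norm (minus (fsum f L) (fsum f L0)) <=
    fsum (fun i => norm (f i)) L - fsum (fun i => norm (f i)) L0.
Proof.
  intros HL0 HL Hi. destruct (nodup_split L0 L) as [N [HP _]]; auto.
  rewrite !(fsum_perm _ _ _ HP), !fsum_app.
  apply Rle_trans with (norm (fsum f N)).
  { apply Req_le, f_equal.
    exact (minus_plus_l (G := NormedModule.AbelianGroup R_AbsRing V) _ _). }
  eapply Rle_trans; [apply norm_fsum|].
  change (@plus R_AbelianMonoid) with Rplus. lra.
Qed.

Lemma norm_minus_le (x y z : V) :
  norm (minus x y) <= norm (minus x z) + norm (minus y z).
Proof.
  rewrite (minus_trans z).
  rewrite <- (norm_opp (minus y z)), opp_minus. apply norm_triangle.
Qed.

End Unordered.

(** Completeness. Partial sums are Cauchy because a finite set whose sum of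
    norms is within [eps / 2] of the supremum leaves less than that for all
    the remaining indices. *)
Lemma usum_exists {I : Type} {V : CompleteNormedModule R_AbsRing} (f : I -> V) (M : R) :
  sum_le (fun i => norm (f i)) M -> exists s, usum f s.
Proof.
  intros HM.
  destruct (proj1 (filterlim_locally_cauchy (U := V) (F := finsets I) (fsum f)))
    as [s Hs]; [intros eps|exists s; exact Hs].
  set (E := fun x => exists L, NoDup L /\ x = fsum (fun i => norm (f i)) L).
  destruct (completeness E) as [m [Hub Hlub]].
  - exists M. intros x (L & HL & ->). now apply HM.
  - exists 0, nil. split; [constructor|reflexivity].
  - assert (HL0 : exists L0, NoDup L0 /\
      m - eps / 2 < fsum (fun i => norm (f i)) L0).
    { apply NNPP. intros Hn. assert (m <= m - eps / 2).
      { apply Hlub. intros x (L & HL & ->). apply Rnot_lt_le. intros Hlt.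
        apply Hn. eauto. }
      pose proof (cond_pos eps). lra. }
    destruct HL0 as [L0 [HL0 Hm]].
    exists (fun L => norm (minus (fsum f L) (fsum f L0)) < eps / 2).
    split.
    + exists L0. intros L HL Hi.
      eapply Rle_lt_trans; [now apply (norm_fsum_tail (V := V) f L0 L)|].
      assert (HLm : fsum (fun i => norm (f i)) L <= m)
        by (apply Hub; unfold E; eauto).
      lra.
    + intros L L' H H'. apply (norm_compat1 (V := V)).
      eapply Rle_lt_trans; [apply (norm_minus_le (V := V) _ _ (fsum f L0))|].
      replace (pos eps) with (eps / 2 + eps / 2) by field. now apply Rplus_lt_compat.
Qed.

(** * Complex numbers as a real normed space *)

Notation C_monoid := (NormedModule.AbelianMonoid R_AbsRing C_R_NormedModule).
Notation csum := (@fsum _ C_monoid).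
Notation cusum := (@usum _ C_R_NormedModule).

Lemma norm_Cmod (z : C) : @norm R_AbsRing C_R_NormedModule z = Cmod z.
Proof.
  destruct z as [x y]. unfold norm; simpl. unfold prod_norm, norm, Cmod, abs; simpl.
  apply f_equal. rewrite !Rmult_1_r. now rewrite <- !Rabs_mult, !Rabs_pos_eq by apply Rle_0_sqr.
Qed.

Lemma scal_Cmult (r : R) (z : C) :
  @scal R_AbsRing C_R_NormedModule r z = Cmult (RtoC r) z.
Proof.
  destruct z as [x y]. unfold scal; simpl. unfold prod_scal, scal; simpl.
  unfold Cmult, mult; simpl. f_equal; ring.
Qed.

Lemma fsum_mult_prod {I J : Type} {K : Ring} (f : I -> K) (g : J -> K)
    (A : list I) (B : list J) :
  fsum (fun x => mult (f (fst x)) (g (snd x))) (list_prod A B) =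
  mult (fsum f A) (fsum g B).
Proof.
  rewrite fsum_prod. simpl.
  transitivity (fsum (fun i => mult (f i) (fsum g B)) A).
  - apply fsum_ext. intros i _. induction B as [|j B IH]; simpl.
    + now rewrite mult_zero_r.
    + now rewrite IH, mult_distr_l.
  - induction A as [|i A IH]; simpl.
    + now rewrite mult_zero_l.
    + now rewrite IH, mult_distr_r.
Qed.

Lemma csum_ext {I : Type} (f g : I -> C) (L : list I) :
  (forall i, In i L -> f i = g i) -> csum f L = csum g L.
Proof. exact (fsum_ext (G := C_monoid) f g L). Qed.

Lemma csum_mult_l {I : Type} (c : C) (f : I -> C) (L : list I) :
  csum (fun i => Cmult c (f i)) L = Cmult c (csum f L).
Proof.
  induction L as [|i L IH]; simpl.
  - symmetry; apply Cmult_0_r.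
  - rewrite IH. symmetry. apply Cmult_plus_distr_l.
Qed.

Lemma csum_RtoC {I : Type} (f : I -> R) (L : list I) :
  csum (fun i => RtoC (f i)) L = RtoC (fsum f L).
Proof.
  induction L as [|i L IH]; simpl; [reflexivity|].
  rewrite IH. symmetry. apply RtoC_plus.
Qed.

Lemma cusum_mult_l {I : Type} (c : C) (f : I -> C) (s : C) :
  cusum f s -> cusum (fun i => Cmult c (f i)) (Cmult c s).
Proof.
  apply (usum_map (V := C_R_NormedModule) (W := C_R_NormedModule) (Cmult c)).
  - apply Cmult_0_r.
  - apply Cmult_plus_distr_l.
  - apply (filterlim_locally_ball_norm (U := C_R_NormedModule)
      (F := @locally C_R_NormedModule s)).
    intros eps.
    assert (Hd : 0 < eps / (Cmod c + 1)).
    { apply Rdiv_lt_0_compat; [apply cond_pos|].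
      pose proof (Cmod_ge_0 c). lra. }
    apply (locally_le_locally_norm (V := C_R_NormedModule)).
    exists (mkposreal _ Hd). intros y Hy. unfold ball_norm in *.
    simpl in Hy. rewrite norm_Cmod in Hy |- *.
    change (Cmod (c * y - c * s)%C < eps). change (Cmod (y - s)%C < eps / (Cmod c + 1)) in Hy.
    replace (c * y - c * s)%C with (c * (y - s))%C by ring.
    rewrite Cmod_mult. pose proof (Cmod_ge_0 c). pose proof (Cmod_ge_0 (y - s)).
    apply Rle_lt_trans with ((Cmod c + 1) * Cmod (y - s)); [nra|].
    apply Rmult_lt_compat_l with (r := Cmod c + 1) in Hy; [|lra].
    replace ((Cmod c + 1) * (eps / (Cmod c + 1))) with (pos eps) in Hy by (field; lra).
    assumption.
Qed.


(** * Double power series and the binomial theorem *)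

(** Divided powers [x^p/p!], for which the binomial theorem is a plain
    convolution without binomial coefficients. *)
Definition rdivpow (x : R) (p : nat) : R := x ^ p / INR (fact p).
Definition divpow (z : C) (p : nat) : C := (z ^ p / RtoC (INR (fact p)))%C.

Lemma Cmult_reg_l (c x y : C) : c <> 0 -> (c * x = c * y)%C -> x = y.
Proof.
  intros Hc H. rewrite <- (Cmult_1_l x), <- (Cmult_1_l y), <- (Cinv_l c Hc).
  now rewrite <- !Cmult_assoc, H.
Qed.

Lemma INR_fact_C (p : nat) : RtoC (INR (fact p)) <> RtoC 0.
Proof. intros H. apply RtoC_inj in H. now apply INR_fact_neq_0 in H. Qed.

Lemma divpow_S (z : C) (p : nat) :
  (RtoC (INR (S p)) * divpow z (S p))%C = (z * divpow z p)%C.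
Proof.
  unfold divpow. rewrite Cpow_S, fact_simpl, mult_INR, RtoC_mult.
  field. split; [apply INR_fact_C|].
  intros H. apply RtoC_inj in H. now apply not_0_INR in H.
Qed.

Lemma divpow_0 (z : C) : divpow z 0 = 1.
Proof. unfold divpow. simpl. field. Qed.

(** Binomial theorem for divided powers, by induction: multiply by [p + 1] and
    write [p + 1 = i + (p + 1 - i)] inside the sum, so that one factor of each
    product absorbs it. *)
Lemma divpow_plus (u v : C) (p : nat) :
  csum (fun i => divpow u i * divpow v (p - i))%C (seq 0 (S p)) =
  divpow (u + v) p.
Proof.
  induction p as [|p IH].
  - simpl. rewrite plus_zero_r, !divpow_0. ring.
  - assert (Hp : RtoC (INR (S p)) <> 0).
    { intros H. apply RtoC_inj in H. now apply not_0_INR in H. }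
    apply (Cmult_reg_l (RtoC (INR (S p))) _ _ Hp).
    rewrite divpow_S, <- csum_mult_l.
    transitivity (Cplus
      (csum (fun i => RtoC (INR i) * divpow u i * divpow v (S p - i))%C
        (seq 0 (S (S p))))
      (csum (fun i => RtoC (INR (S p - i)) * divpow u i * divpow v (S p - i))%C
        (seq 0 (S (S p))))).
    + etransitivity; [|apply (fsum_plus (G := C_monoid))].
      apply csum_ext. intros i Hi. apply in_seq in Hi.
      change (@plus (C_monoid)) with Cplus.
      rewrite minus_INR by lia. rewrite RtoC_minus. ring.
    + rewrite Cmult_plus_distr_r, <- IH, <- !csum_mult_l. f_equal.
      * change (seq 0 (S (S p))) with (0%nat :: seq 1 (S p)).
        rewrite <- seq_shift. cbn [fsum fold_right].
        fold (csum (fun i => RtoC (INR i) * divpow u i * divpow v (S p - i))%C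
               (map S (seq 0 (S p)))).
        rewrite fsum_map, !Cmult_0_l.
        change (@plus C_monoid) with Cplus. rewrite Cplus_0_l.
        apply csum_ext. intros i _. rewrite divpow_S.
        replace (S p - S i)%nat with (p - i)%nat by lia. ring.
      * rewrite seq_S, fsum_app. cbn [fsum fold_right Nat.add].
        rewrite Nat.sub_diag, !Cmult_0_l.
        change (@plus C_monoid) with Cplus. change (@zero C_monoid) with (RtoC 0).
        rewrite !Cplus_0_r.
        apply csum_ext. intros i Hi. apply in_seq in Hi.
        replace (S p - i)%nat with (S (p - i)) by lia.
        transitivity (divpow u i * (RtoC (INR (S (p - i))) * divpow v (S (p - i))))%C;
          [ring|]. rewrite divpow_S. ring.
Qed.

Lemma Cmod_divpow (z : C) (p : nat) : Cmod (divpow z p) = rdivpow (Cmod z) p.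
Proof.
  unfold divpow, rdivpow. rewrite Cmod_div by apply INR_fact_C.
  rewrite Cmod_R, Rabs_pos_eq by apply pos_INR. f_equal.
  induction p as [|p IH]; simpl; [apply Cmod_1|]. now rewrite Cmod_mult, IH.
Qed.

Lemma divpow_RtoC (x : R) (p : nat) : divpow (RtoC x) p = RtoC (rdivpow x p).
Proof. unfold divpow, rdivpow. rewrite RtoC_div, RtoC_pow; [reflexivity|apply INR_fact_neq_0]. Qed.

Lemma rdivpow_plus (x y : R) (p : nat) :
  fsum (fun i => rdivpow x i * rdivpow y (p - i)) (seq 0 (S p)) =
  rdivpow (x + y) p.
Proof.
  apply RtoC_inj. rewrite <- csum_RtoC, <- divpow_RtoC, RtoC_plus, <- divpow_plus.
  apply csum_ext. intros i _. now rewrite RtoC_mult, !divpow_RtoC.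
Qed.

Lemma rdivpow_ge0 (x : R) (p : nat) : 0 <= x -> 0 <= rdivpow x p.
Proof.
  intros H. apply Rdiv_le_0_compat; [now apply pow_le|apply INR_fact_lt_0].
Qed.

(** The monomials [z^p/p! * conj(z)^q/q!], and their absolute values. *)
Definition mono (z : C) (pq : nat * nat) : C :=
  (divpow z (fst pq) * divpow (Cconj z) (snd pq))%C.
Definition rmono (x : R) (pq : nat * nat) : R :=
  rdivpow x (fst pq) * rdivpow x (snd pq).

Lemma rmono_ge0 (x : R) (pq : nat * nat) : 0 <= x -> 0 <= rmono x pq.
Proof. intros H. apply Rmult_le_pos; now apply rdivpow_ge0. Qed.

Lemma Cmod_mono (z : C) (pq : nat * nat) : Cmod (mono z pq) = rmono (Cmod z) pq.
Proof. unfold mono. now rewrite Cmod_mult, !Cmod_divpow, Cmod_conj. Qed.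

(** Absolute convergence of the double power series with coefficients [K] on
    the circle of radius [X]. *)
Definition summable_at (K : nat * nat -> C) (X : R) : Prop :=
  exists M, sum_le (fun pq => Cmod (K pq) * rmono X pq) M.

Definition padd (x y : nat * nat) : nat * nat :=
  ((fst x + fst y)%nat, (snd x + snd y)%nat).
Definition psub (x y : nat * nat) : nat * nat :=
  ((fst x - fst y)%nat, (snd x - snd y)%nat).

(** The pairs that are componentwise at most [x], over which the binomial
    theorem for [mono] sums. *)
Definition below (x : nat * nat) : list (nat * nat) :=
  list_prod (seq 0 (S (fst x))) (seq 0 (S (snd x))).

Lemma in_below (x y : nat * nat) :
  In y (below x) <-> (fst y <= fst x /\ snd y <= snd x)%nat.
Proof.
  destruct x as [p q], y as [i s]. unfold below.
  rewrite in_prod_iff, !in_seq. simpl. lia.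
Qed.

Lemma nodup_below (x : nat * nat) : NoDup (below x).
Proof. apply NoDup_list_prod; apply seq_NoDup. Qed.

Lemma mono_plus (w v : C) (x : nat * nat) :
  csum (fun y => mono w y * mono v (psub x y))%C (below x) = mono (w + v) x.
Proof.
  unfold mono at 3. rewrite Cplus_conj, <- !divpow_plus.
  etransitivity;
    [|exact (fsum_mult_prod (K := C_Ring)
        (fun i => divpow w i * divpow v (fst x - i))%C
        (fun i => divpow (Cconj w) i * divpow (Cconj v) (snd x - i))%C
        (seq 0 (S (fst x))) (seq 0 (S (snd x))))].
  apply csum_ext.
  intros y _. unfold mono, psub. simpl. change (@mult C_Ring) with Cmult. ring.
Qed.

Lemma rmono_plus (a b : R) (x : nat * nat) :
  fsum (fun y => rmono a y * rmono b (psub x y)) (below x) = rmono (a + b) x.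
Proof.
  unfold rmono at 3. rewrite <- !rdivpow_plus.
  etransitivity;
    [|exact (fsum_mult_prod (K := R_Ring)
        (fun i => rdivpow a i * rdivpow b (fst x - i))
        (fun i => rdivpow a i * rdivpow b (snd x - i))
        (seq 0 (S (fst x))) (seq 0 (S (snd x))))].
  apply (fsum_ext (G := R_AbelianMonoid)).
  intros y _. unfold rmono, psub. simpl. change (@mult R_Ring) with Rmult. ring.
Qed.

(** * Change of centre in a double power series *)

(** The family obtained by expanding every monomial of the double series at
    [w + v]. It is indexed by the exponents of [v] first, then of [w]. *)
Definition shifted (K : nat * nat -> C) (w v : C) (x : (nat * nat) * (nat * nat))
    : C :=
  (K (padd (snd x) (fst x)) * mono w (snd x) * mono v (fst x))%C.

(** The same family as [shifted], indexed by the exponents of [w + v] first,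
    and extended by [0] so that the index type is a full product. *)
Definition binom_cells (K : nat * nat -> C) (w v : C)
    (x : (nat * nat) * (nat * nat)) : C :=
  if andb (Nat.leb (fst (snd x)) (fst (fst x))) (Nat.leb (snd (snd x)) (snd (fst x)))
  then (K (fst x) * (mono w (snd x) * mono v (psub (fst x) (snd x))))%C
  else 0.

Lemma binom_cells_in K w v x y :
  In y (below x) ->
  binom_cells K w v (x, y) = (K x * (mono w y * mono v (psub x y)))%C.
Proof.
  intros H. apply in_below in H as [H1 H2]. unfold binom_cells. simpl.
  apply Nat.leb_le in H1, H2. now rewrite H1, H2.
Qed.

Lemma binom_cells_out K w v x y :
  ~ In y (below x) -> binom_cells K w v (x, y) = 0.
Proof.
  intros H. rewrite in_below in H. unfold binom_cells. simpl.
  destruct (Nat.leb_spec (fst y) (fst x)); simpl; [|reflexivity].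
  destruct (Nat.leb_spec (snd y) (snd x)); simpl; [lia|reflexivity].
Qed.

Definition shift_cell (x : (nat * nat) * (nat * nat)) : (nat * nat) * (nat * nat) :=
  (padd (snd x) (fst x), snd x).

Lemma shift_cell_inj x y : shift_cell x = shift_cell y -> x = y.
Proof.
  destruct x as [[j t] [i s]], y as [[j' t'] [i' s']]. unfold shift_cell, padd; simpl.
  intros [= H1 H2 -> ->]. repeat f_equal; lia.
Qed.

Lemma binom_cells_shift_cell K w v x : binom_cells K w v (shift_cell x) = shifted K w v x.
Proof.
  destruct x as [[j t] [i s]]. unfold shift_cell. simpl fst; simpl snd.
  rewrite binom_cells_in.
  - unfold shifted, psub, padd. simpl fst; simpl snd.
    replace (i + j - i)%nat with j by lia.
    replace (s + t - s)%nat with t by lia. ring.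
  - apply in_below. unfold padd. simpl. lia.
Qed.

Lemma binom_cells_support K w v x :
  (forall y, shift_cell y <> x) -> binom_cells K w v x = 0.
Proof.
  destruct x as [[p q] [i s]]. intros H. apply binom_cells_out.
  rewrite in_below. simpl. intros [H1 H2].
  apply (H ((p - i, q - s), (i, s))%nat).
  unfold shift_cell, padd. simpl. repeat f_equal; lia.
Qed.

Lemma binom_cells_sum K w v x :
  cusum (fun y => binom_cells K w v (x, y)) (K x * mono (w + v) x)%C.
Proof.
  rewrite <- mono_plus, <- csum_mult_l.
  rewrite (csum_ext _ (fun y => binom_cells K w v (x, y))).
  - apply (usum_finite (V := C_R_NormedModule) (fun y => binom_cells K w v (x, y))
      (below x) (nodup_below x)).
    intros y. apply binom_cells_out.
  - intros y Hy. now rewrite binom_cells_in.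
Qed.

(** Taking absolute values turns the binomial theorem for [w + v] into the one
    for the real number [|w| + |v|]; hence convergence at that radius is all
    that a change of centre needs. *)
Lemma binom_cells_le K w v :
  summable_at K (Cmod w + Cmod v) ->
  exists M, sum_le (fun x => Cmod (binom_cells K w v x)) M.
Proof.
  intros [M HM]. exists M.
  apply (sum_le_prod _ (fun x => Cmod (K x) * rmono (Cmod w + Cmod v) x)); auto.
  - intros x. apply Cmod_ge_0.
  - intros x. rewrite <- rmono_plus, <- fsum_scal.
    rewrite (fsum_ext _ (fun y => Cmod (binom_cells K w v (x, y)))).
    + apply (sum_le_finite (fun y => Cmod (binom_cells K w v (x, y)))
        (below x) (nodup_below x)).
      * intros y. apply Cmod_ge_0.
      * intros y Hy. now rewrite binom_cells_out, Cmod_0.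
    + intros y Hy. now rewrite binom_cells_in, !Cmod_mult, !Cmod_mono.
Qed.

Lemma shifted_le K w v :
  summable_at K (Cmod w + Cmod v) ->
  exists M, sum_le (fun x => Cmod (shifted K w v x)) M.
Proof.
  intros H. destruct (binom_cells_le K w v H) as [M HM]. exists M.
  eapply sum_le_weaken; [|apply (sum_le_inj shift_cell _ _ shift_cell_inj HM)].
  intros x. cbv beta. rewrite binom_cells_shift_cell. apply Rle_refl.
Qed.

Lemma shifted_sum K w v s :
  summable_at K (Cmod w + Cmod v) ->
  cusum (fun x => K x * mono (w + v) x)%C s -> cusum (shifted K w v) s.
Proof.
  intros H Hs. destruct (binom_cells_le K w v H) as [M HM].
  destruct (usum_exists (V := C_R_CompleteNormedModule) (binom_cells K w v) M)
    as [s' Hs'].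
  { eapply sum_le_weaken; [|exact HM]. intros x. apply Req_le, norm_Cmod. }
  assert (E : s = s').
  { eapply usum_unique; [exact Hs|]. eapply usum_prod; [exact Hs'|].
    apply binom_cells_sum. }
  rewrite E.
  apply (usum_ext (V := C_R_NormedModule) (fun x => binom_cells K w v (shift_cell x))).
  - intros x. apply binom_cells_shift_cell.
  - apply (usum_inj (V := C_R_NormedModule) shift_cell _ _ shift_cell_inj); [|exact Hs'].
    intros x. apply binom_cells_support.
Qed.

(** * Absolutely convergent complex sums *)

Definition asum {I : Type} (f : I -> C) (s : C) : Prop :=
  cusum f s /\ exists M, sum_le (fun i => Cmod (f i)) M.

Lemma asum_exists {I : Type} (f : I -> C) :
  (exists M, sum_le (fun i => Cmod (f i)) M) -> exists s, asum f s.
Proof.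
  intros [M HM].
  destruct (usum_exists (V := C_R_CompleteNormedModule) f M) as [s Hs].
  - eapply sum_le_weaken; [|exact HM]. intros i. apply Req_le, norm_Cmod.
  - exists s. split; [exact Hs|eauto].
Qed.

Lemma asum_ext {I : Type} (f g : I -> C) (s : C) :
  (forall i, f i = g i) -> asum f s -> asum g s.
Proof.
  intros H [Hs [M HM]]. split.
  - exact (usum_ext (V := C_R_NormedModule) f g s H Hs).
  - exists M. eapply sum_le_weaken; [|exact HM]. intros i.
    cbv beta. rewrite H. apply Rle_refl.
Qed.

Lemma asum_unique {I : Type} (f : I -> C) (s t : C) :
  asum f s -> asum f t -> s = t.
Proof. intros [Hs _] [Ht _]. exact (usum_unique (V := C_R_NormedModule) f s t Hs Ht). Qed.

Lemma asum_plus {I : Type} (f g : I -> C) (s t : C) :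
  asum f s -> asum g t -> asum (fun i => f i + g i)%C (s + t)%C.
Proof.
  intros [Hf [M HM]] [Hg [N HN]]. split.
  - exact (usum_plus (V := C_R_NormedModule) f g s t Hf Hg).
  - exists (M + N). eapply sum_le_weaken; [|exact (sum_le_plus _ _ _ _ HM HN)].
    intros i. apply Cmod_triangle.
Qed.

Lemma asum_mult_l {I : Type} (c : C) (f : I -> C) (s : C) :
  asum f s -> asum (fun i => c * f i)%C (c * s)%C.
Proof.
  intros [Hs [M HM]]. split; [now apply cusum_mult_l|].
  exists (Cmod c * M).
  eapply sum_le_weaken; [|exact (sum_le_scal _ _ _ (Cmod_ge_0 c) HM)].
  intros i. apply Req_le, Cmod_mult.
Qed.

Lemma asum_zero {I : Type} (f : I -> C) : (forall i, f i = 0) -> asum f 0.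
Proof.
  intros H. split.
  - apply (usum_finite (V := C_R_NormedModule) f nil); [constructor|auto].
  - exists 0. intros L _. apply Req_le, (fsum_zero (G := R_AbelianMonoid)).
    intros i _. now rewrite H, Cmod_0.
Qed.

Lemma asum_single {I : Type} (f : I -> C) (i : I) :
  (forall j, j <> i -> f j = 0) -> asum f (f i).
Proof.
  intros H. assert (Hn : NoDup [i]) by (constructor; [intros []|constructor]).
  assert (Ho : forall j, ~ In j [i] -> f j = 0).
  { intros j Hj. apply H. intros ->. apply Hj. now left. }
  split.
  - replace (f i) with (csum f [i]).
    + now apply (usum_finite (V := C_R_NormedModule) f [i]).
    + apply (plus_zero_r (G := C_monoid)).
  - exists (fsum (fun j => Cmod (f j)) [i]). apply sum_le_finite; auto.
    + intros j. apply Cmod_ge_0.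
    + intros j Hj. now rewrite Ho, Cmod_0.
Qed.

Lemma asum_inj {I J : Type} (phi : I -> J) (f : J -> C) (s : C) :
  (forall i i', phi i = phi i' -> i = i') ->
  (forall j, (forall i, phi i <> j) -> f j = 0) ->
  asum f s -> asum (fun i => f (phi i)) s.
Proof.
  intros Hphi Hz [Hs [M HM]]. split.
  - now apply (usum_inj (V := C_R_NormedModule) phi).
  - exists M. exact (sum_le_inj phi _ _ Hphi HM).
Qed.

Lemma asum_prod {I J : Type} (f : I * J -> C) (g : I -> C) (s : C) :
  asum f s -> (forall i, cusum (fun j => f (i, j)) (g i)) -> asum g s.
Proof.
  intros [Hs [M HM]] Hg. split.
  - exact (usum_prod (V := C_R_NormedModule) f g s Hs Hg).
  - exists M.
    eapply sum_le_weaken;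
      [|apply (sum_le_usum_prod (V := C_R_NormedModule) f g M); [|exact Hg]].
    + intros i. apply Req_le. symmetry. apply norm_Cmod.
    + eapply sum_le_weaken; [|exact HM]. intros x. apply Req_le, norm_Cmod.
Qed.

Lemma sum_le_ex_series (g : nat -> R) (M : R) :
  (forall k, 0 <= g k) -> sum_le g M -> ex_series g.
Proof.
  intros H0 HM.
  destruct (usum_exists (V := R_CompleteNormedModule) g M) as [s Hs].
  - eapply sum_le_weaken; [|exact HM]. intros k. apply Req_le.
    now apply Rabs_pos_eq.
  - exists s. exact (usum_is_series (V := R_NormedModule) g s Hs).
Qed.

Lemma asum_is_abs_series (u : nat -> C) (s : C) : asum u s -> is_abs_series u s.
Proof.
  intros [Hs [M HM]]. split.
  - apply sum_le_ex_series with M; [|exact HM]. intros k. apply Cmod_ge_0.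
  - exact (usum_is_series (V := C_R_NormedModule) u s Hs).
Qed.

(** The integers as two half-lines, those from [l] up and those from [l - 1]
    down, so that Fubini over [bool * nat] cuts a sum over the integers. *)
Definition half_lines (l : Z) (x : bool * nat) : Z :=
  if fst x then (l + Z.of_nat (snd x))%Z else (l - 1 - Z.of_nat (snd x))%Z.

Lemma asum_split_Z (l : Z) (u : Z -> C) (s : C) :
  asum u s -> exists s1 s2, is_sum_le (l - 1) u s1 /\ is_sum_ge l u s2 /\
    s = (s1 + s2)%C.
Proof.
  intros Hs.
  assert (Hb : asum (fun x => u (half_lines l x)) s).
  { apply asum_inj; [| |exact Hs].
    - intros [[] i] [[] j]; unfold half_lines; simpl; intros H;
        f_equal; lia.
    - intros m Hm. exfalso. destruct (Z_le_gt_dec l m) as [H|H].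
      + apply (Hm (true, Z.to_nat (m - l))). unfold half_lines; simpl. lia.
      + apply (Hm (false, Z.to_nat (l - 1 - m))). unfold half_lines; simpl. lia. }
  assert (Hh : forall b, exists t, asum (fun k => u (half_lines l (b, k))) t).
  { intros b. destruct Hb as [_ [M HM]]. apply asum_exists. exists M.
    apply (sum_le_inj (fun k => (b, k)) _ _) in HM; [exact HM|].
    now intros i j [= H]. }
  destruct (Hh false) as [s1 H1], (Hh true) as [s2 H2].
  exists s1, s2. split; [|split].
  - now apply asum_is_abs_series in H1.
  - now apply asum_is_abs_series in H2.
  - assert (Hg : asum (fun b : bool => if b then s2 else s1) s).
    { apply (asum_prod _ _ _ Hb). intros []; [apply H2|apply H1]. }
    apply (asum_unique _ _ _ Hg).
    apply asum_ext with (fun b : bool => (if b then 0 else s1) + (if b then s2 else 0))%C.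
    { intros []; ring. }
    apply asum_plus.
    + apply (asum_single (fun b : bool => if b then RtoC 0 else s1) false).
      now intros [].
    + apply (asum_single (fun b : bool => if b then s2 else RtoC 0) true).
      now intros [].
Qed.

Lemma asum_is_sum_Z (u : Z -> C) (s : C) : asum u s -> is_sum_Z u s.
Proof.
  intros H. destruct (asum_split_Z 0 u s H) as (s1 & s2 & H1 & H2 & E).
  exists s1, s2. auto.
Qed.

Lemma is_series_unique_C (u : nat -> C) (s t : C) :
  @is_series R_AbsRing C_R_NormedModule u s ->
  @is_series R_AbsRing C_R_NormedModule u t -> s = t.
Proof. apply (filterlim_locally_unique (V := C_R_NormedModule)). Qed.

Lemma is_sum_Z_unique (u : Z -> C) (s t : C) :
  is_sum_Z u s -> is_sum_Z u t -> s = t.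
Proof.
  intros (s1 & s2 & [_ H1] & [_ H2] & ->) (t1 & t2 & [_ H3] & [_ H4] & ->).
  now rewrite (is_series_unique_C _ _ _ H1 H3), (is_series_unique_C _ _ _ H2 H4).
Qed.

Lemma is_abs_series_ext (u v : nat -> C) (s : C) :
  (forall k, u k = v k) -> is_abs_series u s -> is_abs_series v s.
Proof.
  intros H [H1 H2]. split.
  - eapply ex_series_ext; [|exact H1]. intros k. simpl. now rewrite H.
  - exact (is_series_ext (V := C_R_NormedModule) _ _ _ H H2).
Qed.

Lemma is_sum_ge_ext (l : Z) (u v : Z -> C) (s : C) :
  (forall m, (l <= m)%Z -> u m = v m) -> is_sum_ge l u s -> is_sum_ge l v s.
Proof. intros H. apply is_abs_series_ext. intros k. apply H. lia. Qed.

Lemma is_sum_le_ext (l : Z) (u v : Z -> C) (s : C) :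
  (forall m, (m <= l)%Z -> u m = v m) -> is_sum_le l u s -> is_sum_le l v s.
Proof. intros H. apply is_abs_series_ext. intros k. apply H. lia. Qed.

Lemma is_abs_series_zero (u : nat -> C) (s : C) :
  (forall k, u k = 0) -> is_abs_series u s -> s = 0.
Proof.
  intros H [_ Hs]. apply (is_series_unique_C _ _ _ Hs).
  apply asum_is_abs_series, asum_zero, H.
Qed.

(** * Recentred coefficients *)

(** Coefficients of the double power series about the new centre [w]: the
    Taylor shift of [K]. *)
Definition recenter (K : nat * nat -> C) (w : C) (x : nat * nat) : C :=
  @iota C_R_CompleteNormedModule
    (fun s => asum (fun y => K (padd y x) * mono w y)%C s).

Lemma rdivpow_gt0 (x : R) (p : nat) : 0 < x -> 0 < rdivpow x p.
Proof.
  intros H. apply Rdiv_lt_0_compat; [now apply pow_lt|apply INR_fact_lt_0].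
Qed.

(** The section of the family [shifted] at exponent [x] of [v], divided by a
    monomial in [v] that is nonzero as soon as [v = Y > 0]. *)
Lemma summable_at_shift (K : nat * nat -> C) (w : C) (Y : R) (x : nat * nat) :
  0 < Y -> summable_at K (Cmod w + Y) ->
  exists M, sum_le (fun y => Cmod (K (padd y x) * mono w y)%C) M.
Proof.
  intros HY H.
  assert (HYC : Cmod (RtoC Y) = Y) by (rewrite Cmod_R; apply Rabs_pos_eq; lra).
  rewrite <- HYC in H. destruct (shifted_le K w (RtoC Y) H) as [M HM].
  apply (sum_le_inj (fun y => (x, y))) in HM; [|now intros y y' [= E]].
  set (c := rmono Y x).
  assert (Hc : 0 < c) by (apply Rmult_lt_0_compat; now apply rdivpow_gt0).
  exists (/ c * M).
  eapply sum_le_weaken;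
    [|refine (sum_le_scal (/ c) _ _ _ HM); now apply Rlt_le, Rinv_0_lt_compat].
  intros y. unfold shifted. simpl. rewrite (Cmod_mult (_ * _)), (Cmod_mono (RtoC Y)), HYC.
  fold c. apply Req_le. field. lra.
Qed.

Lemma recenter_sum (K : nat * nat -> C) (w : C) (Y : R) (x : nat * nat) :
  0 < Y -> summable_at K (Cmod w + Y) ->
  asum (fun y => K (padd y x) * mono w y)%C (recenter K w x).
Proof.
  intros HY H. destruct (asum_exists _ (summable_at_shift K w Y x HY H)) as [s Hs].
  apply (iota_correct (V := C_R_CompleteNormedModule)
    (fun s => asum (fun y => K (padd y x) * mono w y)%C s)).
  exists s. split; [exact Hs|]. intros t. now apply asum_unique.
Qed.

Lemma recenter_expand (K : nat * nat -> C) (w v : C) (Y : R) (s : C) :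
  0 < Y -> summable_at K (Cmod w + Y) -> summable_at K (Cmod w + Cmod v) ->
  cusum (fun x => K x * mono (w + v) x)%C s ->
  asum (fun x => recenter K w x * mono v x)%C s.
Proof.
  intros HY HgY Hg Hs. apply asum_prod with (shifted K w v).
  - split; [now apply shifted_sum|now apply shifted_le].
  - intros x. unfold shifted. simpl. rewrite Cmult_comm.
    apply (usum_ext (V := C_R_NormedModule)
      (fun y => mono v x * (K (padd y x) * mono w y))%C).
    + intros y. apply Cmult_comm.
    + apply cusum_mult_l. now apply (recenter_sum K w Y x HY).
Qed.

(** A bijection between [Z * nat] and [nat * nat] whose row [m] runs along the
    diagonal [p - q = m - l], starting from the boundary of the quadrant. *)
Definition diagonal (l : Z) (x : Z * nat) : nat * nat :=
  ((snd x + Z.to_nat (fst x - l))%nat, (snd x + Z.to_nat (l - fst x))%nat).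

Lemma sum_by_diagonals (l : Z) (u : nat * nat -> C) (U : Z -> C) (s : C) :
  asum u s -> (forall m, asum (fun k => u (diagonal l (m, k))) (U m)) -> asum U s.
Proof.
  intros Hs HU. apply asum_prod with (fun x => u (diagonal l x)).
  - apply asum_inj; [| |exact Hs].
    + intros [m k] [m' k']. unfold diagonal; simpl. intros [= H1 H2].
      f_equal; lia.
    + intros [p q] H. exfalso.
      apply (H (l + Z.of_nat p - Z.of_nat q, Nat.min p q)%Z).
      unfold diagonal. simpl. f_equal; lia.
  - intros m. apply HU.
Qed.

Lemma sum_le_diagonal (g : nat * nat -> R) (M : R) :
  sum_le (fun x => g (diagonal 0 x)) M -> sum_le g M.
Proof.
  intros H.
  apply (sum_le_inj (fun x : nat * nat =>
    (Z.of_nat (fst x) - Z.of_nat (snd x), Nat.min (fst x) (snd x))%Z)) in H.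
  - eapply sum_le_weaken; [|exact H]. intros [p q]. apply Req_le. f_equal.
    unfold diagonal. simpl. f_equal; lia.
  - intros [p q] [p' q']. simpl. intros [= H1 H2]. f_equal; lia.
Qed.

(** * Bessel series *)

Lemma series_sum_le (g : nat -> R) (s : R) :
  (forall k, 0 <= g k) -> is_series g s -> sum_le g s.
Proof.
  intros H0 Hs L HL.
  destruct (nodup_split L (seq 0 (S (list_max L)))) as [N [HP _]].
  - exact HL.
  - apply seq_NoDup.
  - intros k Hk. apply in_seq. split; [lia|].
    pose proof (proj1 (list_max_le L _) (le_n _)) as Hf.
    rewrite Forall_forall in Hf. specialize (Hf _ Hk). lia.
  - apply Rle_trans with (fsum g (seq 0 (S (list_max L)))).
    + rewrite (fsum_perm _ _ _ HP), fsum_app.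
      rewrite <- (Rplus_0_r (fsum g L)) at 1.
      apply Rplus_le_compat_l, fsum_ge0, H0.
    + rewrite fsum_sum_n. apply (is_lim_seq_incr_compare _ _ Hs).
      intros n. rewrite sum_Sn. unfold plus; simpl. specialize (H0 (S n)). lra.
Qed.

Lemma rdivpow_series (x : R) : is_series (rdivpow x) (exp x).
Proof.
  apply (is_series_ext (V := R_NormedModule)
    (fun n => scal (pow_n x n) (/ INR (fact n)))).
  - intros n. rewrite pow_n_pow. reflexivity.
  - exact (is_exp_Reals x).
Qed.

(** The [k]-th term of the series of [I_N(2 X)]; it is also the modulus of the
    [k]-th monomial on a diagonal at distance [N] from the main one. *)
Definition bterm (N : nat) (X : R) (k : nat) : R :=
  rdivpow X k * rdivpow X (k + N).

Lemma bterm_ge0 N X k : 0 <= X -> 0 <= bterm N X k.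
Proof. intros H. apply Rmult_le_pos; now apply rdivpow_ge0. Qed.

Lemma bterm_le N X k :
  0 <= X -> bterm N X k <= rdivpow X N * rdivpow (X * X) k.
Proof.
  intros H. unfold bterm, rdivpow. rewrite pow_add, Rpow_mult_distr.
  pose proof (INR_fact_lt_0 k). pose proof (INR_fact_lt_0 N).
  assert (Hf : / INR (fact (k + N)) <= / INR (fact N)).
  { apply Rinv_le_contravar; [assumption|]. apply le_INR, fact_le. lia. }
  apply Rle_trans with (X ^ k * X ^ k * X ^ N * / INR (fact k) * / INR (fact (k + N))).
  - right. unfold Rdiv. ring.
  - apply Rle_trans with (X ^ k * X ^ k * X ^ N * / INR (fact k) * / INR (fact N)).
    + apply Rmult_le_compat_l; [|assumption].
      repeat apply Rmult_le_pos; try now apply pow_le.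
      now apply Rlt_le, Rinv_0_lt_compat.
    + right. unfold Rdiv. ring.
Qed.

Lemma bterm_sum_le N X :
  0 <= X -> sum_le (bterm N X) (rdivpow X N * exp (X * X)).
Proof.
  intros H.
  apply sum_le_weaken with (fun k => rdivpow X N * rdivpow (X * X) k).
  - intros k. now apply bterm_le.
  - apply sum_le_scal; [now apply rdivpow_ge0|].
    apply series_sum_le; [|apply rdivpow_series].
    intros k. apply rdivpow_ge0. nra.
Qed.

Lemma bterm_ex_series N X : 0 <= X -> ex_series (bterm N X).
Proof.
  intros H. apply sum_le_ex_series with (rdivpow X N * exp (X * X)).
  - intros k. now apply bterm_ge0.
  - now apply bterm_sum_le.
Qed.

Lemma besselI_bterm n x : besselI n x = Series (bterm (Z.abs_nat n) (x / 2)).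
Proof.
  apply Series_ext. intros k. unfold bterm, rdivpow.
  replace (2 * k + Z.abs_nat n)%nat with (k + (k + Z.abs_nat n))%nat by lia.
  rewrite (pow_add _ k). field. split; apply INR_fact_neq_0.
Qed.

(** The subtracted term in [besselP] is the first term of the Bessel series. *)
Lemma besselP_bterm lambda n r :
  0 <= lambda * r ->
  besselP lambda n r =
  Series (fun k => bterm (Z.abs_nat n) (lambda * r / 2) (S k)).
Proof.
  intros H. unfold besselP. rewrite besselI_bterm, Series_incr_1.
  - unfold bterm at 1. unfold rdivpow. simpl. field. apply INR_fact_neq_0.
  - apply bterm_ex_series. lra.
Qed.

Lemma asum_RtoC (t : nat -> R) (v : C) :
  (forall k, 0 <= t k) -> ex_series t ->
  asum (fun k => RtoC (t k) * v)%C (RtoC (Series t) * v)%C.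
Proof.
  intros H0 Ht. apply Series_correct in Ht.
  pose proof (series_sum_le t _ H0 Ht) as HM.
  destruct (asum_exists (fun k => RtoC (t k) * v)%C) as [s Hs].
  - exists (Cmod v * Series t).
    eapply sum_le_weaken; [|exact (sum_le_scal _ _ _ (Cmod_ge_0 v) HM)].
    intros k. rewrite Cmod_mult, Cmod_R, Rabs_pos_eq by apply H0. apply Req_le. ring.
  - replace (RtoC (Series t) * v)%C with s; [exact Hs|].
    destruct (asum_is_abs_series _ _ Hs) as [_ Hs'].
    apply (is_series_unique_C _ _ _ Hs').
    apply (is_series_ext (V := C_R_NormedModule) (fun k => scal (t k) v)).
    { intros k. apply scal_Cmult. }
    rewrite <- scal_Cmult. unfold is_series.
    apply filterlim_ext with (fun n => @scal R_AbsRing C_R_NormedModule (sum_n t n) v).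
    { intros n. induction n as [|n IH].
      - now rewrite !sum_O.
      - rewrite !sum_Sn, <- IH. exact (scal_distr_r (V := C_R_NormedModule) _ _ _). }
    apply (filterlim_comp _ _ _ (sum_n t)
      (fun r => @scal R_AbsRing C_R_NormedModule r v) eventually
      (locally (Series t))); [exact Ht|].
    exact (filterlim_scal_l (V := C_R_NormedModule) (Series t) v).
Qed.

Lemma bessel_asum n X (v : C) :
  0 <= X ->
  asum (fun k => RtoC (bterm (Z.abs_nat n) X k) * v)%C
    (RtoC (besselI n (2 * X)) * v)%C.
Proof.
  intros H. rewrite besselI_bterm. replace (2 * X / 2) with X by field.
  apply asum_RtoC; [intros k; now apply bterm_ge0|now apply bterm_ex_series].
Qed.

Lemma besselP_asum lambda n r (v : C) :
  0 <= lambda * r ->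
  asum (fun k => match k with O => 0
                 | S _ => RtoC (bterm (Z.abs_nat n) (lambda * r / 2) k) * v end)%C
    (RtoC (besselP lambda n r) * v)%C.
Proof.
  intros H. set (X := lambda * r / 2). assert (HX : 0 <= X) by (unfold X; lra).
  set (t := fun k => match k with O => 0 | S _ => bterm (Z.abs_nat n) X k end).
  assert (Ht : ex_series t).
  { apply ex_series_incr_1. apply (ex_series_incr_1 (bterm (Z.abs_nat n) X)).
    now apply bterm_ex_series. }
  rewrite besselP_bterm by exact H. fold X.
  replace (Series (fun k => bterm (Z.abs_nat n) X (S k))) with (Series t).
  - apply asum_ext with (fun k => RtoC (t k) * v)%C.
    + intros [|k]; [apply Cmult_0_l|reflexivity].
    + apply asum_RtoC; [|exact Ht]. intros [|k]; [apply Rle_refl|].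
      now apply bterm_ge0.
  - rewrite Series_incr_1 by exact Ht. simpl. apply Rplus_0_l.
Qed.

Lemma expi_plus s t : expi (s + t) = (expi s * expi t)%C.
Proof.
  unfold expi, Cmult. simpl. rewrite cos_plus, sin_plus. f_equal; ring.
Qed.

Lemma expi_pow t n : (expi t ^ n)%C = expi (INR n * t).
Proof.
  induction n as [|n IH].
  - simpl. unfold expi. now rewrite Rmult_0_l, cos_0, sin_0.
  - rewrite Cpow_S, IH, <- expi_plus, S_INR. f_equal. ring.
Qed.

Lemma Cconj_expi t : Cconj (expi t) = expi (- t).
Proof. unfold expi, Cconj. simpl. now rewrite cos_neg, sin_neg. Qed.

Lemma Cmod_expi t : Cmod (expi t) = 1.
Proof.
  unfold Cmod, expi. simpl. rewrite !Rmult_1_r, Rplus_comm.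
  pose proof (sin2_cos2 t) as H. unfold Rsqr in H. now rewrite H, sqrt_1.
Qed.

Lemma Cconj_RtoC (x : R) : Cconj (RtoC x) = RtoC x.
Proof. unfold Cconj, RtoC. simpl. now rewrite Ropp_0. Qed.

Lemma divpow_polar X t p :
  divpow (RtoC X * expi t)%C p = (RtoC (rdivpow X p) * expi (INR p * t))%C.
Proof.
  rewrite <- divpow_RtoC, <- expi_pow. unfold divpow.
  rewrite Cpow_mult_l. unfold Cdiv. ring.
Qed.

(** On a diagonal the angular factor is constant and the moduli are the terms
    of a Bessel series; this is where Bessel functions enter. *)
Lemma mono_polar X t n k :
  mono (RtoC X * expi t)%C ((k + Z.to_nat n)%nat, (k + Z.to_nat (- n))%nat) =
  (RtoC (bterm (Z.abs_nat n) X k) * expi (IZR n * t))%C.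
Proof.
  unfold mono. simpl fst; simpl snd.
  rewrite Cmult_conj, Cconj_RtoC, Cconj_expi, !divpow_polar.
  replace (IZR n * t) with
    (INR (k + Z.to_nat n) * t + INR (k + Z.to_nat (- n)) * - t).
  2: { rewrite !plus_INR, !INR_IZR_INZ.
       replace (IZR n) with (IZR (Z.of_nat (Z.to_nat n) - Z.of_nat (Z.to_nat (- n))))
         by (f_equal; lia).
       rewrite minus_IZR. ring. }
  rewrite expi_plus. unfold bterm. rewrite RtoC_mult.
  destruct (Z_le_gt_dec 0 n) as [H|H].
  - replace (Z.to_nat (- n)) with 0%nat by lia.
    replace (Z.abs_nat n) with (Z.to_nat n) by lia. rewrite Nat.add_0_r. ring.
  - replace (Z.to_nat n) with 0%nat by lia.
    replace (Z.abs_nat n) with (Z.to_nat (- n)) by lia. rewrite Nat.add_0_r. ring.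
Qed.

(** * Expansions as double power series *)

(** Membership in the boundary of the quadrant. Each diagonal meets it exactly
    once, and that point carries the monomial missing from [besselP]. *)
Definition edge (x : nat * nat) : bool := Nat.eqb (Nat.min (fst x) (snd x)) 0.
Definition pdiff (x : nat * nat) : Z := (Z.of_nat (fst x) - Z.of_nat (snd x))%Z.

Definition twofact (l : Z) : C :=
  RtoC (2 ^ Z.abs_nat l * INR (fact (Z.abs_nat l))).

(** The double power series hidden in an expansion: [a] fills the interior of
    the quadrant, constantly along diagonals, and [b] fills its boundary. *)
Definition power_coef_a (a : Z -> C) (x : nat * nat) : C :=
  if edge x then 0 else a (pdiff x).
Definition power_coef_b (b : Z -> C) (x : nat * nat) : C :=
  if edge x then (b (pdiff x) * twofact (pdiff x))%C else 0.
Definition power_coef (a b : Z -> C) (x : nat * nat) : C :=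
  (power_coef_a a x + power_coef_b b x)%C.

(** The boundary point of the diagonal [p - q = l]. *)
Definition posneg (l : Z) : nat * nat := (Z.to_nat l, Z.to_nat (- l)).

Lemma pdiff_diagonal l m k x :
  pdiff x = l -> pdiff (padd (diagonal l (m, k)) x) = m.
Proof. destruct x as [j t]. unfold pdiff, padd, diagonal. simpl. lia. Qed.

Lemma edge_diagonal l m k x :
  edge (padd (diagonal l (m, k)) x) =
  match k with O => edge (padd (posneg (m - l)) x) | S _ => false end.
Proof.
  destruct x as [j t]. unfold edge, padd, diagonal, posneg. simpl fst; simpl snd.
  destruct k as [|k].
  - f_equal. lia.
  - apply Nat.eqb_neq. lia.
Qed.

Lemma mono_diagonal X t l m k :
  mono (RtoC X * expi t)%C (diagonal l (m, k)) =
  (RtoC (bterm (Z.abs_nat (l - m)) X k) * expi (- (IZR (l - m) * t)))%C.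
Proof.
  unfold diagonal. simpl fst; simpl snd.
  replace (l - m)%Z with (- (m - l))%Z by lia.
  rewrite mono_polar, opp_IZR. f_equal; [|f_equal; ring].
  do 2 f_equal. lia.
Qed.

(** One diagonal of the series for a recentred coefficient. Its first
    coefficient is missing exactly when the shifted diagonal still starts on
    the boundary, which turns [I] into [P]. *)
Lemma diagonal_sum_a lambda a rho theta l m x :
  0 <= lambda * rho -> pdiff x = l ->
  asum (fun k => power_coef_a a (padd (diagonal l (m, k)) x) *
                 mono (RtoC (lambda * rho / 2) * expi theta) (diagonal l (m, k)))%C
    (if edge (padd (posneg (m - l)) x)
     then aP_term lambda a rho theta l m else aI_term lambda a rho theta l m).
Proof.
  intros H Hx.
  set (E := expi (- (IZR (l - m) * theta))).
  destruct (edge (padd (posneg (m - l)) x)) eqn:He.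
  - unfold aP_term. fold E.
    replace (a m * RtoC (besselP lambda (l - m) rho) * E)%C
      with (a m * (RtoC (besselP lambda (l - m) rho) * E))%C by ring.
    refine (asum_ext _ _ _ _ (asum_mult_l (a m) _ _
      (besselP_asum lambda (l - m) rho E H))).
    intros k. unfold power_coef_a. rewrite edge_diagonal, pdiff_diagonal, mono_diagonal, He by assumption.
    fold E. destruct k; ring.
  - unfold aI_term. fold E.
    replace (a m * RtoC (besselI (l - m) (lambda * rho)) * E)%C
      with (a m * (RtoC (besselI (l - m) (2 * (lambda * rho / 2))) * E))%C.
    2: { replace (2 * (lambda * rho / 2)) with (lambda * rho) by field. ring. }
    refine (asum_ext _ _ _ _ (asum_mult_l (a m) _ _
      (bessel_asum (l - m) (lambda * rho / 2) E _))); [|lra].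
    intros k. unfold power_coef_a. rewrite edge_diagonal, pdiff_diagonal, mono_diagonal, He by assumption.
    fold E. now destruct k.
Qed.

(** The shifted diagonal starts on the boundary only if [l] and [m - l] do not
    have opposite signs. *)
Lemma edge_posneg m l :
  edge (padd (posneg (m - l)) (posneg l)) = true ->
  Z.abs_nat m = (Z.abs_nat l + Z.abs_nat (l - m))%nat.
Proof.
  unfold edge, padd, posneg. simpl fst; simpl snd. intros H.
  apply Nat.eqb_eq in H. lia.
Qed.

Lemma pdiff_posneg l : pdiff (posneg l) = l.
Proof. unfold pdiff, posneg. simpl. lia. Qed.

(** A diagonal carries at most one of the [b]s, and there the quotient of the
    factorials is a binomial coefficient. *)
Lemma diagonal_sum_b lambda b rho theta l m :
  asum (fun k => power_coef_b b (padd (diagonal l (m, k)) (posneg l)) *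
                 mono (RtoC (lambda * rho / 2) * expi theta) (diagonal l (m, k)))%C
    (if edge (padd (posneg (m - l)) (posneg l))
     then (twofact l * b_term lambda b rho theta l m)%C else 0).
Proof.
  set (f := fun k => (power_coef_b b (padd (diagonal l (m, k)) (posneg l)) *
                 mono (RtoC (lambda * rho / 2) * expi theta) (diagonal l (m, k)))%C).
  assert (Hf : (if edge (padd (posneg (m - l)) (posneg l))
     then (twofact l * b_term lambda b rho theta l m)%C else RtoC 0) = f O).
  { unfold f, power_coef_b. rewrite edge_diagonal, mono_diagonal, pdiff_diagonal by apply pdiff_posneg.
    destruct (edge _) eqn:He; [|ring].
    pose proof (edge_posneg _ _ He) as Hm.
    unfold b_term. set (E := expi _).
    unfold twofact, bterm, rdivpow, Binomial.C. rewrite Hm.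
    replace (Z.abs_nat l + Z.abs_nat (l - m) - Z.abs_nat l)%nat
      with (Z.abs_nat (l - m)) by lia.
    set (N := Z.abs_nat l). set (D := Z.abs_nat (l - m)).
    transitivity (b m * E * RtoC (2 ^ N * INR (fact N) *
      (INR (fact (N + D)) / (INR (fact N) * INR (fact D))) * (lambda * rho) ^ D))%C.
    { rewrite !RtoC_mult. ring. }
    transitivity (b m * E * RtoC (2 ^ (N + D) * INR (fact (N + D)) *
      ((lambda * rho / 2) ^ 0 / INR (fact 0) *
       ((lambda * rho / 2) ^ (0 + D) / INR (fact (0 + D))))))%C.
    2: { rewrite !RtoC_mult. ring. }
    do 2 f_equal.
    replace ((lambda * rho / 2) ^ (0 + D)) with ((lambda * rho) ^ D / 2 ^ D)
      by (unfold Rdiv; rewrite (Rpow_mult_distr (lambda * rho)), pow_inv; reflexivity).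
    rewrite pow_add. simpl. field. repeat split; try apply INR_fact_neq_0. apply pow_nonzero. lra. }
  rewrite Hf. apply asum_single. intros [|k] Hk; [easy|].
  unfold f, power_coef_b. rewrite edge_diagonal. apply Cmult_0_l.
Qed.

Lemma Cmod_power_coef_a_le a b x : Cmod (power_coef_a a x) <= Cmod (power_coef a b x).
Proof.
  unfold power_coef, power_coef_a, power_coef_b. destruct (edge x).
  - rewrite Cmod_0. apply Cmod_ge_0.
  - rewrite Cplus_0_r. apply Rle_refl.
Qed.

Lemma Cmod_power_coef_b_le a b x : Cmod (power_coef_b b x) <= Cmod (power_coef a b x).
Proof.
  unfold power_coef, power_coef_a, power_coef_b. destruct (edge x).
  - rewrite Cplus_0_l. apply Rle_refl.
  - rewrite Cmod_0. apply Cmod_ge_0.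
Qed.

(** * Growth of the coefficients of a convergent expansion *)

Lemma linear_le_geometric (s : R) :
  1 < s -> exists M, forall n : nat, INR n + 1 <= M * s ^ n.
Proof.
  intros Hs. exists (1 + / (s - 1)). intros n.
  assert (H : 1 + INR n * (s - 1) <= s ^ n).
  { replace s with (1 + (s - 1)) at 2 by ring. apply poly. lra. }
  assert (Hi : 0 < / (s - 1)) by (apply Rinv_0_lt_compat; lra).
  apply Rle_trans with ((1 + / (s - 1)) * (1 + INR n * (s - 1))).
  - replace ((1 + / (s - 1)) * (1 + INR n * (s - 1))) with
      (1 + INR n * (s - 1) + / (s - 1) + INR n) by (field; lra).
    pose proof (pos_INR n). nra.
  - apply Rmult_le_compat_l; lra.
Qed.

Lemma sum_le_bool (x y : R) :
  0 <= x -> 0 <= y -> sum_le (fun b : bool => if b then x else y) (x + y).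
Proof.
  intros Hx Hy.
  replace (x + y) with (fsum (fun b : bool => if b then x else y) [true; false]).
  - apply sum_le_finite.
    + repeat constructor; simpl; intuition discriminate.
    + now intros [].
    + intros [] H; exfalso; apply H; simpl; auto.
  - simpl. change (@plus R_AbelianMonoid) with Rplus.
    change (@zero R_AbelianMonoid) with 0. ring.
Qed.

Lemma geometric_Z (q : R) :
  0 <= q < 1 -> exists M, sum_le (fun m : Z => q ^ Z.abs_nat m) M.
Proof.
  intros Hq.
  assert (Hg : sum_le (fun k => q ^ k) (/ (1 - q))).
  { apply series_sum_le.
    - intros k. now apply pow_le.
    - apply is_series_geom. rewrite Rabs_pos_eq; lra. }
  exists (/ (1 - q) + / (1 - q)).
  apply (sum_le_inj (fun m : Z => (Z.leb 0 m, Z.abs_nat m))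
    (fun x : bool * nat => q ^ snd x)).
  - intros m m'. intros [= H1 H2].
    destruct (Z.leb_spec 0 m), (Z.leb_spec 0 m'); try discriminate; lia.
  - apply (sum_le_prod _ (fun b : bool => if b then / (1 - q) else / (1 - q))).
    + intros x. now apply pow_le.
    + now intros [].
    + apply sum_le_bool; now apply sum_le_ge0 in Hg.
Qed.

(** A bound at all smaller radii gives summability at all of them, since
    increasing the radius slightly wins a geometric factor. *)
Lemma power_bound_summable (g : Z -> R) (X0 : R) :
  (forall m, 0 <= g m) ->
  (forall X, 0 <= X < X0 ->
     exists M, forall m, g m * X ^ Z.abs_nat m <= M * (INR (Z.abs_nat m) + 1)) ->
  forall X, 0 <= X < X0 ->
    exists M, sum_le (fun m => g m * X ^ Z.abs_nat m) M.
Proof.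
  intros Hg H X HX.
  (* From [X1] to [Y] the linear factor is absorbed, from [Y] to [X] a
     geometric series is gained. *)
  set (X1 := (X + X0) / 2). set (Y := (X + X1) / 2).
  assert (HX1 : X < X1 < X0) by (unfold X1; lra).
  assert (HY : X < Y < X1) by (unfold Y; lra).
  destruct (H X1) as [M HM]; [lra|].
  destruct (linear_le_geometric (X1 / Y)) as [N HN].
  { apply Rmult_lt_reg_r with Y; [lra|]. unfold Rdiv.
    rewrite Rmult_assoc, Rinv_l; lra. }
  destruct (geometric_Z (X / Y)) as [G HG].
  { split; [apply Rdiv_le_0_compat; lra|].
    apply Rmult_lt_reg_r with Y; [lra|]. unfold Rdiv.
    rewrite Rmult_assoc, Rinv_l; lra. }
  assert (HM0 : 0 <= M).
  { specialize (HM 0%Z). specialize (Hg 0%Z). simpl in HM. lra. }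
  assert (HN0 : 0 <= N).
  { specialize (HN 0%nat). simpl in HN. lra. }
  exists (M * N * G).
  apply sum_le_weaken with (fun m => M * N * (X / Y) ^ Z.abs_nat m).
  2: { apply sum_le_scal; [nra|exact HG]. }
  intros m. specialize (HM m). specialize (HN (Z.abs_nat m)).
  set (n := Z.abs_nat m) in *.
  assert (HYn : 0 < Y ^ n) by (apply pow_lt; lra).
  assert (HX1n : 0 < X1 ^ n) by (apply pow_lt; lra).
  assert (HXn : 0 <= X ^ n) by (apply pow_le; lra).
  unfold Rdiv in *. rewrite Rpow_mult_distr, pow_inv in *.
  assert (HgY : g m * Y ^ n <= M * N).
  { apply Rmult_le_reg_r with (X1 ^ n * / Y ^ n).
    - apply Rmult_lt_0_compat; [assumption|now apply Rinv_0_lt_compat].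
    - apply Rle_trans with (M * (INR n + 1)).
      + eapply Rle_trans; [|exact HM]. right. field. lra.
      + rewrite Rmult_assoc. apply Rmult_le_compat_l; assumption. }
  apply Rle_trans with (g m * Y ^ n * (X ^ n * / Y ^ n)).
  - right. field. lra.
  - apply Rmult_le_compat_r; [|assumption].
    apply Rmult_le_pos; [assumption|]. now apply Rlt_le, Rinv_0_lt_compat.
Qed.

(** The Bessel series without its first term, that is [besselP] as a function
    of [X = lambda * r / 2]. *)
Definition btail (N : nat) (X : R) : R := Series (fun k => bterm N X (S k)).

Lemma btail_le N X : 0 <= X -> 0 <= btail N X <= rdivpow X N * exp (X * X).
Proof.
  intros HX. pose proof (bterm_ex_series N X HX) as He.
  assert (He' : ex_series (fun k => bterm N X (S k)))
    by now apply (ex_series_incr_1 (bterm N X)).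
  apply Series_correct in He as Hs. apply Series_correct in He' as Hs'.
  split.
  - apply (sum_le_ge0 (fun k => bterm N X (S k))).
    apply series_sum_le; [|exact Hs']. intros k. now apply bterm_ge0.
  - assert (HS : Series (bterm N X) <= rdivpow X N * exp (X * X)).
    { rewrite <- (is_series_unique _ _ (rdivpow_series (X * X))), <- Series_scal_l.
      apply Series_le.
      - intros k. split; [now apply bterm_ge0|now apply bterm_le].
      - apply (ex_series_scal_l (V := R_NormedModule)). eexists. apply rdivpow_series. }
    rewrite Series_incr_1 in HS by exact He. unfold btail.
    pose proof (bterm_ge0 N X 0 HX). lra.
Qed.

(** Termwise, the difference on the right is nonnegative; the left-hand side is
    the contribution of the terms of index [1]. *)
Lemma btail_gap N X1 X2 :
  0 <= X1 <= X2 ->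
  X1 ^ N * X2 ^ N * (X2 ^ 2 - X1 ^ 2) / INR (fact (S N)) <=
  X1 ^ N * btail N X2 - X2 ^ N * btail N X1.
Proof.
  intros H.
  assert (He : forall X, 0 <= X -> ex_series (fun k => bterm N X (S k))).
  { intros X HX. apply (ex_series_incr_1 (bterm N X)). now apply bterm_ex_series. }
  unfold btail. rewrite <- !Series_scal_l, <- Series_minus.
  2, 3: apply (ex_series_scal_l (V := R_NormedModule)), He; lra.
  set (d := fun k => X1 ^ N * bterm N X2 (S k) - X2 ^ N * bterm N X1 (S k)).
  assert (Hd : forall k, d k = X1 ^ N * X2 ^ N *
      ((X2 ^ S k) ^ 2 - (X1 ^ S k) ^ 2) / (INR (fact (S k)) * INR (fact (S k + N)))).
  { intros k. unfold d, bterm, rdivpow. rewrite !(pow_add _ (S k)).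
    field. split; apply INR_fact_neq_0. }
  assert (Hd0 : forall k, 0 <= d k).
  { intros k. rewrite Hd. apply Rdiv_le_0_compat.
    - apply Rmult_le_pos; [apply Rmult_le_pos; apply pow_le; lra|].
      assert (0 <= X1 ^ S k <= X2 ^ S k).
      { split; [apply pow_le; lra|]. apply pow_incr. lra. }
      nra.
    - apply Rmult_lt_0_compat; apply INR_fact_lt_0. }
  assert (Hs : ex_series d).
  { apply (ex_series_minus (V := R_NormedModule));
      apply (ex_series_scal_l (V := R_NormedModule)), He; lra. }
  apply Series_correct in Hs. pose proof (series_sum_le d _ Hd0 Hs) as Hle.
  apply (sum_le_term d _ 0%nat) in Hle. rewrite Hd in Hle.
  eapply Rle_trans; [|exact Hle]. right. simpl. field.
  apply (INR_fact_neq_0 (S N)).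
Qed.

Lemma besselP_btail lambda n r :
  0 <= lambda * r ->
  besselP lambda n r = btail (Z.abs_nat n) (lambda * r / 2).
Proof. apply besselP_bterm. Qed.

Lemma rmono_diagonal X m k :
  rmono X (diagonal 0 (m, k)) = bterm (Z.abs_nat m) X k.
Proof.
  unfold rmono, diagonal, bterm. cbn [fst snd].
  destruct (Z_le_gt_dec 0 m) as [H|H].
  - replace (Z.to_nat (0 - m)) with 0%nat by lia.
    replace (Z.to_nat (m - 0)) with (Z.abs_nat m) by lia.
    rewrite Nat.add_0_r. ring.
  - replace (Z.to_nat (m - 0)) with 0%nat by lia.
    replace (Z.to_nat (0 - m)) with (Z.abs_nat m) by lia.
    rewrite Nat.add_0_r. ring.
Qed.

Section Summability.

Context (a b : Z -> C) (X0 : R)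
  (expansion_bounded : forall X, 0 <= X < X0 ->
    exists M, forall m, Cmod (a m * RtoC (btail (Z.abs_nat m) X) +
                              b m * RtoC ((2 * X) ^ Z.abs_nat m))%C <= M).

(** The hypothesis controls only the sum of the [a]-part and the [b]-part. The
    [b]-part is a pure power of the radius, so a suitable combination of the
    bounds at two radii eliminates it; by [btail_gap] what remains of the
    [a]-part is not too small. *)
Lemma a_summable X :
  0 <= X < X0 ->
  exists M, sum_le (fun m => Cmod (a m) * rdivpow X (Z.abs_nat m)) M.
Proof.
  intros HX.
  destruct (power_bound_summable
    (fun m => Cmod (a m) / INR (fact (Z.abs_nat m))) X0) with X as [M HM].
  - intros m. apply Rdiv_le_0_compat; [apply Cmod_ge_0|apply INR_fact_lt_0].
  - clear X HX. intros X1 HX1. set (X2 := (X1 + X0) / 2).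
    assert (HX2 : X1 < X2 < X0) by (unfold X2; lra).
    destruct (expansion_bounded X1) as [M1 H1]; [lra|].
    destruct (expansion_bounded X2) as [M2 H2]; [lra|].
    exists ((M1 + M2) / (X2 ^ 2 - X1 ^ 2)). intros m.
    specialize (H1 m). specialize (H2 m). set (N := Z.abs_nat m) in *.
    set (u1 := (a m * _ + _)%C) in H1. set (u2 := (a m * _ + _)%C) in H2.
    assert (Hgap := btail_gap N X1 X2 ltac:(lra)).
    set (P1 := btail N X1) in *. set (P2 := btail N X2) in *.
    assert (HX1N : 0 <= X1 ^ N) by (apply pow_le; lra).
    assert (HX2N : 0 < X2 ^ N) by (apply pow_lt; lra).
    assert (HX12 : X1 ^ N <= X2 ^ N) by (apply pow_incr; lra).
    assert (Hsq : 0 < X2 ^ 2 - X1 ^ 2) by nra.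
    (* The weights are chosen so that the two multiples of [b m] cancel. *)
    assert (E : (RtoC (X1 ^ N) * u2 - RtoC (X2 ^ N) * u1)%C =
                (a m * RtoC (X1 ^ N * P2 - X2 ^ N * P1))%C).
    { unfold u1, u2. rewrite !Rpow_mult_distr, !RtoC_minus, !RtoC_mult. ring. }
    assert (Hu : Cmod (a m) * (X1 ^ N * P2 - X2 ^ N * P1) <= X2 ^ N * (M1 + M2)).
    { apply Rle_trans with (Cmod (RtoC (X1 ^ N) * u2 - RtoC (X2 ^ N) * u1)%C).
      - rewrite E, Cmod_mult, Cmod_R. apply Rmult_le_compat_l; [apply Cmod_ge_0|].
        apply Rle_abs.
      - unfold Cminus. eapply Rle_trans; [apply Cmod_triangle|].
        rewrite Cmod_opp, !Cmod_mult, !Cmod_R, !Rabs_pos_eq by lra.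
        pose proof (Cmod_ge_0 u1). pose proof (Cmod_ge_0 u2). nra. }
    assert (Hf : INR (fact (S N)) = (INR N + 1) * INR (fact N)).
    { rewrite fact_simpl, mult_INR, S_INR. reflexivity. }
    pose proof (INR_fact_lt_0 N) as HfN. pose proof (pos_INR N) as HN.
    rewrite Hf in Hgap.
    apply Rmult_le_reg_r with (X2 ^ N * (X2 ^ 2 - X1 ^ 2) / (INR N + 1)).
    { apply Rdiv_lt_0_compat; [now apply Rmult_lt_0_compat|lra]. }
    apply Rle_trans with (Cmod (a m) * (X1 ^ N * P2 - X2 ^ N * P1)).
    + eapply Rle_trans; [|apply Rmult_le_compat_l; [apply Cmod_ge_0|exact Hgap]].
      right. field. lra.
    + eapply Rle_trans; [exact Hu|]. right. field. lra.
  - exact HX.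
  - exists M. eapply sum_le_weaken; [|exact HM]. intros m. cbv beta.
    unfold rdivpow. right. field. apply INR_fact_neq_0.
Qed.

Lemma b_summable X :
  0 <= X < X0 ->
  exists M, sum_le (fun m => Cmod (b m) * (2 * X) ^ Z.abs_nat m) M.
Proof.
  intros HX.
  destruct (power_bound_summable
    (fun m => Cmod (b m) * 2 ^ Z.abs_nat m) X0) with X as [M HM].
  - intros m. apply Rmult_le_pos; [apply Cmod_ge_0|apply pow_le; lra].
  - clear X HX. intros X HX.
    destruct (a_summable X HX) as [A HA]. destruct (expansion_bounded X HX) as [M HM].
    exists (M + A * exp (X * X)). intros m.
    specialize (HM m). apply (sum_le_term _ _ m) in HA.
    set (N := Z.abs_nat m) in *.
    destruct (btail_le N X) as [HP0 HP]; [lra|].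
    assert (Ha : Cmod (a m * RtoC (btail N X)) <= A * exp (X * X)).
    { rewrite Cmod_mult, Cmod_R, Rabs_pos_eq by assumption.
      apply Rle_trans with (Cmod (a m) * (rdivpow X N * exp (X * X))).
      - apply Rmult_le_compat_l; [apply Cmod_ge_0|assumption].
      - rewrite <- Rmult_assoc. apply Rmult_le_compat_r; [|assumption].
        apply Rlt_le, exp_pos. }
    assert (Hb : Cmod (b m * RtoC ((2 * X) ^ N)) <= M + A * exp (X * X)).
    { replace (b m * RtoC ((2 * X) ^ N))%C with
        ((a m * RtoC (btail N X) + b m * RtoC ((2 * X) ^ N)) +
         - (a m * RtoC (btail N X)))%C by ring.
      eapply Rle_trans; [apply Cmod_triangle|]. rewrite Cmod_opp. lra. }
    rewrite Cmod_mult, Cmod_R, Rabs_pos_eq in Hb by (apply pow_le; lra).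
    rewrite Rpow_mult_distr in Hb. rewrite Rmult_assoc.
    pose proof (pos_INR N). pose proof (Cmod_ge_0 (b m * RtoC ((2 * X) ^ N))).
    assert (0 <= M + A * exp (X * X)).
    { eapply Rle_trans; [|exact Hb]. apply Rmult_le_pos; [apply Cmod_ge_0|].
      apply Rmult_le_pos; apply pow_le; lra. }
    nra.
  - exact HX.
  - exists M. eapply sum_le_weaken; [|exact HM]. intros m. cbv beta.
    rewrite Rpow_mult_distr. right. ring.
Qed.

(** Row by row along the diagonals, bounding the [a]-part by the exponential
    bound on the Bessel series; the [b]-part has one term in each row. *)
Lemma summable_at_power_coef X : 0 <= X < X0 -> summable_at (power_coef a b) X.
Proof.
  intros HX. destruct (a_summable X HX) as [A HA]. destruct (b_summable X HX) as [B HB].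
  exists (exp (X * X) * A + B). apply sum_le_diagonal.
  apply (sum_le_prod _ (fun m => exp (X * X) * (Cmod (a m) * rdivpow X (Z.abs_nat m)) +
                                 Cmod (b m) * (2 * X) ^ Z.abs_nat m)).
  - intros x. apply Rmult_le_pos; [apply Cmod_ge_0|apply rmono_ge0; lra].
  - intros m.
    apply sum_le_weaken with (fun k => Cmod (a m) * bterm (Z.abs_nat m) X k +
      match k with O => Cmod (b m) * (2 * X) ^ Z.abs_nat m | S _ => 0 end).
    + intros k. rewrite rmono_diagonal.
      assert (Hp : pdiff (diagonal 0 (m, k)) = m).
      { unfold pdiff, diagonal. simpl. lia. }
      pose proof (bterm_ge0 (Z.abs_nat m) X k ltac:(lra)) as H0.
      apply Rle_trans with
        (Cmod (power_coef_a a (diagonal 0 (m, k))) * bterm (Z.abs_nat m) X k +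
         Cmod (power_coef_b b (diagonal 0 (m, k))) * bterm (Z.abs_nat m) X k).
      { rewrite <- Rmult_plus_distr_r. apply Rmult_le_compat_r; [exact H0|].
        apply Cmod_triangle. }
      unfold power_coef_a, power_coef_b. rewrite Hp.
      replace (edge (diagonal 0 (m, k))) with (match k with O => true | S _ => false end).
      2: { unfold edge, diagonal. simpl fst; simpl snd.
           destruct k; symmetry; [apply Nat.eqb_eq|apply Nat.eqb_neq]; lia. }
      pose proof (Cmod_ge_0 (a m)).
      destruct k as [|k]; rewrite Cmod_0, ?Rmult_0_l; [|lra].
      apply Rplus_le_compat; [now apply Rmult_le_pos|].
      right. rewrite Cmod_mult. unfold twofact, bterm, rdivpow.
      set (N := Z.abs_nat m). rewrite Cmod_R, Rabs_pos_eq.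
      * rewrite Rpow_mult_distr. simpl. field. apply INR_fact_neq_0.
      * apply Rmult_le_pos; [apply pow_le; lra|apply pos_INR].
    + apply sum_le_plus.
      * rewrite (Rmult_comm (exp _)), Rmult_assoc.
        apply sum_le_scal; [apply Cmod_ge_0|]. apply bterm_sum_le. lra.
      * set (g := fun k => match k with
                  | O => Cmod (b m) * (2 * X) ^ Z.abs_nat m | S _ => 0 end).
        replace (Cmod (b m) * (2 * X) ^ Z.abs_nat m) with (fsum g [O]).
        -- apply sum_le_finite.
           ++ constructor; [intros []|constructor].
           ++ intros [|k]; [|apply Rle_refl].
              apply Rmult_le_pos; [apply Cmod_ge_0|apply pow_le; lra].
           ++ intros [|k] Hk; [|reflexivity]. exfalso. apply Hk. now left.
        -- exact (plus_zero_r (G := R_AbelianMonoid) _).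
  - apply sum_le_plus; [|exact HB]. apply sum_le_scal; [|exact HA].
    apply Rlt_le, exp_pos.
Qed.

End Summability.

(** * Expansions at the old and the new centre *)

Lemma is_sum_Z_bounded (u : Z -> C) (s : C) :
  is_sum_Z u s -> exists M, forall m, Cmod (u m) <= M.
Proof.
  intros (s1 & s2 & [[t1 H1] _] & [[t2 H2] _] & _).
  pose proof (series_sum_le _ t1 (fun k => Cmod_ge_0 _) H1) as B1.
  pose proof (series_sum_le _ t2 (fun k => Cmod_ge_0 _) H2) as B2.
  exists (Rmax t1 t2). intros m. destruct (Z_le_gt_dec 0 m) as [H|H].
  - apply (sum_le_term _ _ (Z.to_nat m)) in B2. cbv beta in B2.
    replace (0 + Z.of_nat (Z.to_nat m))%Z with m in B2 by lia.
    eapply Rle_trans; [exact B2|apply Rmax_r].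
  - apply (sum_le_term _ _ (Z.to_nat (-1 - m))) in B1. cbv beta in B1.
    replace (-1 - Z.of_nat (Z.to_nat (-1 - m)))%Z with m in B1 by lia.
    eapply Rle_trans; [exact B1|apply Rmax_l].
Qed.

Lemma binomC_0 n : Binomial.C n 0 = 1.
Proof.
  unfold Binomial.C. rewrite Nat.sub_0_r. simpl. field. apply INR_fact_neq_0.
Qed.

(** Summing the double series by diagonals gives back the expansion in Bessel
    functions and powers; no coefficient is shifted here, so every diagonal
    starts on the boundary. *)
Lemma expansion_of_power_series lambda c d rho theta s :
  0 <= lambda * rho ->
  asum (fun x => power_coef c d x * mono (RtoC (lambda * rho / 2) * expi theta) x)%C s ->
  asum (expansion_term lambda c d rho theta) s.
Proof.
  intros H Hs. apply (sum_by_diagonals 0 _ _ _ Hs). intros m.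
  pose proof (asum_plus _ _ _ _
    (diagonal_sum_a lambda c rho theta 0 m (posneg 0) H (pdiff_posneg 0))
    (diagonal_sum_b lambda d rho theta 0 m)) as Hi.
  assert (He : edge (padd (posneg (m - 0)) (posneg 0)) = true).
  { unfold edge, padd, posneg. simpl fst; simpl snd. apply Nat.eqb_eq. lia. }
  rewrite He in Hi.
  replace (expansion_term lambda c d rho theta m) with
    (aP_term lambda c rho theta 0 m + twofact 0 * b_term lambda d rho theta 0 m)%C.
  - refine (asum_ext _ _ _ _ Hi). intros k. unfold power_coef.
    replace (padd (diagonal 0 (m, k)) (posneg 0)) with (diagonal 0 (m, k)).
    + ring.
    + unfold padd, posneg. simpl. unfold diagonal. simpl. f_equal; lia.
  - unfold expansion_term, aP_term, b_term, twofact.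
    replace (Z.abs_nat (0 - m)) with (Z.abs_nat m) by lia.
    replace (- (IZR (0 - m) * theta)) with (IZR m * theta)
      by (rewrite minus_IZR; ring).
    replace (besselP lambda (0 - m) rho) with (besselP lambda m rho).
    2: { unfold besselP, besselI. now replace (Z.abs_nat (0 - m)) with (Z.abs_nat m) by lia. }
    replace (Binomial.C (Z.abs_nat m) (Z.abs_nat 0)) with 1.
    + simpl. rewrite Rmult_1_l. ring.
    + symmetry. apply binomC_0.
Qed.

Lemma twofact_neq0 l : twofact l <> 0.
Proof.
  intros H. apply RtoC_inj in H. revert H. apply Rmult_integral_contrapositive.
  split; [apply pow_nonzero; lra|apply INR_fact_neq_0].
Qed.

Lemma inv_2fact_twofact l : inv_2fact l = (/ twofact l)%C.
Proof.
  unfold inv_2fact, twofact. rewrite RtoC_inv; [reflexivity|].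
  intros H. apply (twofact_neq0 l). unfold twofact. now rewrite H.
Qed.

Lemma edge_padd11 x y : edge (padd y (padd (1, 1)%nat x)) = false.
Proof.
  unfold edge, padd. simpl fst; simpl snd. apply Nat.eqb_neq. lia.
Qed.

Lemma edge_shift_true l m :
  ((0 <= l <= m) \/ (m <= l <= 0))%Z ->
  edge (padd (posneg (m - l)) (posneg l)) = true.
Proof.
  intros H. unfold edge, padd, posneg. simpl fst; simpl snd.
  apply Nat.eqb_eq. lia.
Qed.

Lemma edge_shift_false l m :
  ((0 < l /\ m < l) \/ (l < 0 /\ l < m))%Z ->
  edge (padd (posneg (m - l)) (posneg l)) = false.
Proof.
  intros H. unfold edge, padd, posneg. simpl fst; simpl snd.
  apply Nat.eqb_neq. lia.
Qed.

Lemma power_coef_off_edge (a b : Z -> C) x y :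
  edge x = false -> power_coef a b (padd y x) = a (pdiff (padd y x)).
Proof.
  intros H. unfold power_coef, power_coef_a, power_coef_b.
  replace (edge (padd y x)) with false; [ring|].
  unfold edge, padd in *. simpl fst; simpl snd. symmetry.
  apply Nat.eqb_neq. apply Nat.eqb_neq in H. lia.
Qed.

Section Coefficients.

Context (lambda rho0 theta0 Y : R) (a b : Z -> C).
Context (rho0_ge0 : 0 <= lambda * rho0) (Y_pos : 0 < Y).
Let w : C := (RtoC (lambda * rho0 / 2) * expi theta0)%C.
Context (coef_summable : summable_at (power_coef a b) (Cmod w + Y)).

(** Off the boundary the recentred coefficient depends on [p - q = l] only, so
    any off-boundary point of that diagonal may be read, here the second one. *)
Definition new_c (l : Z) : C := recenter (power_coef a b) w (padd (1, 1)%nat (posneg l)).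
Definition new_d (l : Z) : C := (inv_2fact l * recenter (power_coef a b) w (posneg l))%C.

(** The recentred series has again the shape of an expansion: seen from a point
    off the boundary, only the constant-on-diagonals part of the coefficients
    is visible. *)
Lemma recenter_power_coef x : recenter (power_coef a b) w x = power_coef new_c new_d x.
Proof.
  unfold power_coef at 2, power_coef_a, power_coef_b. destruct (edge x) eqn:He.
  - unfold new_d. rewrite inv_2fact_twofact.
    replace (posneg (pdiff x)) with x.
    + field. apply twofact_neq0.
    + destruct x as [j t]. unfold edge in He. apply Nat.eqb_eq in He. simpl in He.
      unfold posneg, pdiff. simpl fst; simpl snd. f_equal; lia.
  - rewrite Cplus_0_r. unfold new_c.
    set (x' := padd _ _). assert (He' : edge x' = false).
    { unfold x', edge, padd. simpl fst; simpl snd. apply Nat.eqb_neq. lia. }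
    apply (asum_unique (fun y => power_coef a b (padd y x) * mono w y)%C).
    + exact (recenter_sum _ w Y x Y_pos coef_summable).
    + refine (asum_ext _ _ _ _ (recenter_sum _ w Y x' Y_pos coef_summable)).
      intros y. rewrite !power_coef_off_edge by assumption. do 2 f_equal.
      unfold x', padd, pdiff, posneg. simpl. lia.
Qed.

Lemma new_c_correct l : is_coef_c lambda a rho0 theta0 l (new_c l).
Proof.
  apply asum_is_sum_Z. set (x := padd (1, 1)%nat (posneg l)).
  assert (Hx : pdiff x = l).
  { unfold x, pdiff, padd, posneg. cbn [fst snd]. lia. }
  apply (sum_by_diagonals l _ _ _ (recenter_sum _ w Y x Y_pos coef_summable)).
  intros m. pose proof (diagonal_sum_a lambda a rho0 theta0 l m x rho0_ge0 Hx) as Hi.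
  unfold x in Hi at 2. rewrite edge_padd11 in Hi.
  refine (asum_ext _ _ _ _ Hi). intros k. fold w. f_equal.
  unfold power_coef, power_coef_a, power_coef_b, x. rewrite edge_padd11. ring.
Qed.

(** The [a]-part and the [b]-part of the series for [d] converge separately,
    since each is dominated by the whole. *)
Lemma new_d_split l :
  exists sa sb,
    asum (fun m => if edge (padd (posneg (m - l)) (posneg l))
          then aP_term lambda a rho0 theta0 l m
          else aI_term lambda a rho0 theta0 l m) sa /\
    asum (fun m => if edge (padd (posneg (m - l)) (posneg l))
          then b_term lambda b rho0 theta0 l m else 0) sb /\
    new_d l = (inv_2fact l * sa + sb)%C.
Proof.
  set (x := posneg l).
  destruct (summable_at_shift _ w Y x Y_pos coef_summable) as [M HM].
  destruct (asum_exists (fun y => power_coef_a a (padd y x) * mono w y)%C) as [sa Ha].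
  { exists M. eapply sum_le_weaken; [|exact HM]. intros y. rewrite !Cmod_mult.
    apply Rmult_le_compat_r; [apply Cmod_ge_0|apply Cmod_power_coef_a_le]. }
  destruct (asum_exists (fun y => power_coef_b b (padd y x) * mono w y)%C) as [sb Hb].
  { exists M. eapply sum_le_weaken; [|exact HM]. intros y. rewrite !Cmod_mult.
    apply Rmult_le_compat_r; [apply Cmod_ge_0|apply Cmod_power_coef_b_le]. }
  exists sa, (inv_2fact l * sb)%C. split; [|split].
  - apply (sum_by_diagonals l _ _ _ Ha). intros m.
    apply (diagonal_sum_a lambda a rho0 theta0 l m x rho0_ge0 (pdiff_posneg l)).
  - refine (asum_ext _ _ _ _ (asum_mult_l (inv_2fact l) _ _
      (sum_by_diagonals l _ _ _ Hb (diagonal_sum_b lambda b rho0 theta0 l)))).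
    intros m. rewrite inv_2fact_twofact. unfold x. destruct (edge _); [|ring].
    field. apply twofact_neq0.
  - unfold new_d. fold x. rewrite <- Cmult_plus_distr_l. f_equal.
    apply (asum_unique _ _ _ (recenter_sum _ w Y x Y_pos coef_summable)).
    refine (asum_ext _ _ _ _ (asum_plus _ _ _ _ Ha Hb)). intros y.
    unfold power_coef. ring.
Qed.

Lemma new_d_pos l : (0 < l)%Z -> is_coef_d_pos lambda a b rho0 theta0 l (new_d l).
Proof.
  intros Hl. destruct (new_d_split l) as (sa & sb & Ha & Hb & E).
  destruct (asum_split_Z l _ _ Ha) as (s1 & s2 & H1 & H2 & ->).
  destruct (asum_split_Z l _ _ Hb) as (t1 & t2 & T1 & T2 & ->).
  exists s1, s2, t2. split; [|split; [|split]].
  - refine (is_sum_le_ext _ _ _ _ _ H1). intros m Hm. now rewrite edge_shift_false by lia.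
  - refine (is_sum_ge_ext _ _ _ _ _ H2). intros m Hm. now rewrite edge_shift_true by lia.
  - refine (is_sum_ge_ext _ _ _ _ _ T2). intros m Hm. now rewrite edge_shift_true by lia.
  - apply is_abs_series_zero in T1; [rewrite E, T1; ring|].
    intros k. now rewrite edge_shift_false by lia.
Qed.

Lemma new_d_neg l : (l < 0)%Z -> is_coef_d_neg lambda a b rho0 theta0 l (new_d l).
Proof.
  intros Hl. destruct (new_d_split l) as (sa & sb & Ha & Hb & E).
  destruct (asum_split_Z (l + 1) _ _ Ha) as (s1 & s2 & H1 & H2 & ->).
  destruct (asum_split_Z (l + 1) _ _ Hb) as (t1 & t2 & T1 & T2 & ->).
  replace (l + 1 - 1)%Z with l in H1, T1 by lia.
  exists s1, s2, t1. split; [|split; [|split]].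
  - refine (is_sum_le_ext _ _ _ _ _ H1). intros m Hm. now rewrite edge_shift_true by lia.
  - refine (is_sum_ge_ext _ _ _ _ _ H2). intros m Hm. now rewrite edge_shift_false by lia.
  - refine (is_sum_le_ext _ _ _ _ _ T1). intros m Hm. now rewrite edge_shift_true by lia.
  - apply is_abs_series_zero in T2; [rewrite E, T2; ring|].
    intros k. now rewrite edge_shift_false by lia.
Qed.

Lemma new_d_zero : is_coef_d_zero lambda a b rho0 theta0 (new_d 0).
Proof.
  destruct (new_d_split 0) as (sa & sb & Ha & Hb & E).
  exists sa, sb.
  assert (Ht : forall m, expi (- (IZR (0 - m) * theta0)) = expi (IZR m * theta0)).
  { intros m. f_equal. rewrite minus_IZR. ring. }
  split; [|split].
  - apply asum_is_sum_Z. refine (asum_ext _ _ _ _ Ha). intros m.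
    rewrite edge_shift_true by lia. unfold aP_term. now rewrite Ht.
  - apply asum_is_sum_Z. refine (asum_ext _ _ _ _ Hb). intros m.
    rewrite edge_shift_true by lia. unfold b_term.
    change (Z.abs_nat 0) with 0%nat. rewrite Ht, binomC_0.
    replace (Z.abs_nat (0 - m)) with (Z.abs_nat m) by lia. ring.
  - rewrite E. unfold inv_2fact. simpl. rewrite Rmult_1_r, Rinv_1. ring.
Qed.

End Coefficients.

(** * Geometry of the boxes *)

Lemma polar_exists (x : R * R) : exists rho theta, is_polar x rho theta.
Proof.
  destruct x as [u v]. set (rho := sqrt (u * u + v * v)).
  assert (Hr : rho * rho = u * u + v * v) by (apply sqrt_sqrt; nra).
  assert (H0 : 0 <= rho) by apply sqrt_pos.
  destruct (Req_dec rho 0) as [E|E].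
  - exists 0, 0. rewrite E in Hr.
    assert (u = 0) by nra. assert (v = 0) by nra.
    split; [lra|]. simpl. split; lra.
  - assert (Hu : -1 <= u / rho <= 1).
    { assert (Hur : u / rho * rho = u) by (field; lra).
      assert (- rho <= u <= rho) by (split; nra).
      split; apply Rmult_le_reg_r with rho; lra. }
    assert (Hs : rho * sin (acos (u / rho)) = Rabs v).
    { rewrite sin_acos by exact Hu. rewrite <- (sqrt_Rsqr rho H0) at 1.
      rewrite <- sqrt_mult_alt by apply Rle_0_sqr.
      rewrite <- sqrt_Rsqr_abs. f_equal. unfold Rsqr.
      transitivity (rho * rho - u * u); [field; lra|nra]. }
    assert (Hc : rho * cos (acos (u / rho)) = u).
    { rewrite cos_acos by exact Hu. field. exact E. }
    destruct (Rle_dec 0 v) as [Hv|Hv].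
    + exists rho, (acos (u / rho)). split; [exact H0|]. simpl.
      rewrite Hs, Hc, Rabs_pos_eq; auto.
    + exists rho, (- acos (u / rho)). split; [exact H0|]. simpl.
      rewrite cos_neg, sin_neg, Hc. split; [reflexivity|].
      rewrite Rabs_left in Hs by lra. lra.
Qed.

Lemma polar_norm v rho theta :
  is_polar v rho theta -> rho * rho = fst v * fst v + snd v * snd v.
Proof.
  intros (_ & -> & ->). pose proof (sin2_cos2 theta) as H. unfold Rsqr in H.
  transitivity (rho * rho * (sin theta * sin theta + cos theta * cos theta));
    [rewrite H; ring|ring].
Qed.

(** In this form the change of centre is addition of complex numbers. *)
Lemma polar_complex k v rho theta :
  is_polar v rho theta ->
  (RtoC (k * rho / 2) * expi theta)%C = (k * fst v / 2, k * snd v / 2).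
Proof.
  intros (_ & -> & ->). unfold expi, Cmult, RtoC. simpl. f_equal; field.
Qed.

Lemma Cmod_polar x theta : 0 <= x -> Cmod (RtoC x * expi theta)%C = x.
Proof.
  intros H. rewrite Cmod_mult, Cmod_expi, Cmod_R, Rabs_pos_eq by exact H. ring.
Qed.

(** Every radius smaller than the distance [sqrt 2 * side / 2] to a corner is
    attained inside the box, on its diagonal. *)
Lemma expands_bounded lambda a b B Psi X :
  0 < lambda -> expands lambda a b B Psi ->
  0 <= X < lambda * (sqrt 2 * side B / 4) ->
  exists M, forall m, Cmod (a m * RtoC (btail (Z.abs_nat m) X) +
                            b m * RtoC ((2 * X) ^ Z.abs_nat m))%C <= M.
Proof.
  intros Hl HB HX. set (r := 2 * X / lambda).
  assert (Hr : lambda * r = 2 * X) by (unfold r; field; lra).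
  assert (Hr0 : 0 <= r) by (apply Rdiv_le_0_compat; lra).
  assert (Hrs : r < sqrt 2 * side B / 2).
  { apply Rmult_lt_reg_l with lambda; [assumption|]. lra. }
  assert (H2 : 0 < sqrt 2) by (apply sqrt_lt_R0; lra).
  assert (Hc : Rabs (r * (1 / sqrt 2)) < side B / 2).
  { rewrite Rabs_pos_eq.
    - apply Rmult_lt_reg_r with (sqrt 2); [assumption|].
      replace (r * (1 / sqrt 2) * sqrt 2) with r by (field; lra). lra.
    - apply Rmult_le_pos; [assumption|]. apply Rdiv_le_0_compat; lra. }
  set (x := (fst (center B) + r * (1 / sqrt 2), snd (center B) + r * (1 / sqrt 2))).
  assert (Hx : inside B x).
  { unfold inside, x. cbn [fst snd]. split.
    - now replace (fst (center B) + r * (1 / sqrt 2) - fst (center B))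
        with (r * (1 / sqrt 2)) by ring.
    - now replace (snd (center B) + r * (1 / sqrt 2) - snd (center B))
        with (r * (1 / sqrt 2)) by ring. }
  assert (Hp : is_polar (vsub x (center B)) r (PI / 4)).
  { split; [assumption|]. unfold vsub, x. cbn [fst snd].
    rewrite cos_PI4, sin_PI4. split; ring. }
  destruct (is_sum_Z_bounded _ _ (HB x Hx r (PI / 4) Hp)) as [M HM].
  exists M. intros m. specialize (HM m). unfold expansion_term in HM.
  rewrite Cmod_mult, Cmod_expi, Rmult_1_r, besselP_btail, Hr in HM by lra.
  now replace (2 * X / 2) with X in HM by field.
Qed.

Theorem lemma9 (lambda : R) (lambda_pos : 0 < lambda)
    (parent child : box)
    (parent_center : center parent = (0, 0))
    (parent_child : child_box parent child)
    (Psi : R * R -> C) (a b : Z -> C)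
    (Psi_expansion : local_expansion lambda a b parent Psi)
    (rho0 theta0 : R)
    (x0_polar : is_polar (center child) rho0 theta0) :
  exists c d : Z -> C,
    (forall l : Z, is_coef_c lambda a rho0 theta0 l (c l)) /\
    (forall l : Z, (0 < l)%Z ->
       is_coef_d_pos lambda a b rho0 theta0 l (d l)) /\
    is_coef_d_zero lambda a b rho0 theta0 (d 0%Z) /\
    (forall l : Z, (l < 0)%Z ->
       is_coef_d_neg lambda a b rho0 theta0 l (d l)) /\
    expands lambda c d child Psi.
Proof.
  destruct Psi_expansion as [_ HPsi].
  destruct parent_child as (Hside & Hx0 & Hy0).
  rewrite parent_center in Hx0, Hy0. cbn [fst snd] in Hx0, Hy0.
  rewrite Rminus_0_r in Hx0, Hy0.
  pose proof (side_pos parent) as Hs.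
  set (h := side parent / 4) in *.
  assert (Hh : 0 < h) by (unfold h; lra).
  set (X0 := lambda * (sqrt 2 * side parent / 4)).
  assert (Hgrow : forall X, 0 <= X < X0 -> summable_at (power_coef a b) X).
  { intros X HX. apply summable_at_power_coef with X0; [|exact HX].
    intros X' HX'. now apply (expands_bounded lambda a b parent Psi). }
  assert (H2 : 0 < sqrt 2) by (apply sqrt_lt_R0; lra).
  assert (H22 : sqrt 2 * sqrt 2 = 2) by (apply sqrt_sqrt; lra).
  assert (Hrho0 : rho0 = sqrt 2 * h).
  { pose proof (polar_norm _ _ _ x0_polar) as Hn. destruct x0_polar as [H0 _].
    apply (f_equal Rsqr) in Hx0. apply (f_equal Rsqr) in Hy0. rewrite <- Rsqr_abs in Hx0, Hy0.
    unfold Rsqr in Hx0, Hy0. rewrite Hx0, Hy0 in Hn.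
    apply Rsqr_inj; [exact H0|nra|]. unfold Rsqr. rewrite Hn. nra. }
  assert (Hlr : 0 <= lambda * rho0) by (rewrite Hrho0; apply Rmult_le_pos; nra).
  set (w := (RtoC (lambda * rho0 / 2) * expi theta0)%C).
  assert (Hw : Cmod w = lambda * rho0 / 2) by (apply Cmod_polar; lra).
  assert (HX0 : X0 = 2 * Cmod w).
  { rewrite Hw, Hrho0. unfold X0, h. field. }
  (* Any radius [Y] with [|w| + Y] in the range of convergence serves to sum the
     new coefficients, even when the point considered is the centre itself. *)
  set (Y := Cmod w / 2).
  assert (HY : 0 < Y).
  { unfold Y. rewrite Hw, Hrho0.
    assert (0 < lambda * (sqrt 2 * h)) by (repeat apply Rmult_lt_0_compat; lra). lra. }
  assert (HgY : summable_at (power_coef a b) (Cmod w + Y)).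
  { apply Hgrow. unfold Y in *. lra. }
  exists (new_c lambda rho0 theta0 a b), (new_d lambda rho0 theta0 a b).
  split; [|split; [|split; [|split]]].
  - intros l. now apply (new_c_correct lambda rho0 theta0 Y).
  - intros l Hl. now apply (new_d_pos lambda rho0 theta0 Y).
  - now apply (new_d_zero lambda rho0 theta0 Y).
  - intros l Hl. now apply (new_d_neg lambda rho0 theta0 Y).
  - intros x Hx rho' theta' Hp.
    destruct (polar_exists x) as (rho & theta & Hpx).
    assert (Hxp : inside parent x).
    { destruct Hx as [Hx1 Hx2]. unfold inside. rewrite parent_center. cbn [fst snd].
      rewrite !Rminus_0_r. rewrite Hside in Hx1, Hx2.
      split; [clear Hx2 Hy0|clear Hx1 Hx0]; unfold h in *;
        split_Rabs; lra. }
    assert (Hr' : rho' < sqrt 2 * h).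
    { pose proof (polar_norm _ _ _ Hp) as Hn. destruct Hp as [H0 _].
      destruct Hx as [Hx1 Hx2]. unfold vsub in Hn. cbn [fst snd] in Hn.
      rewrite Hside in Hx1, Hx2.
      replace (side parent / 2 / 2) with h in Hx1, Hx2 by (unfold h; field).
      apply Rabs_def2 in Hx1, Hx2. apply Rsqr_incrst_0; [|exact H0|nra].
      unfold Rsqr. rewrite Hn.
      replace (sqrt 2 * h * (sqrt 2 * h)) with (h * h + h * h) by nra.
      apply Rplus_lt_compat; nra. }
    assert (Hr'0 : 0 <= rho') by apply Hp.
    assert (Hr0 : 0 <= rho) by apply Hpx.
    set (v := (RtoC (lambda * rho' / 2) * expi theta')%C).
    set (z := (RtoC (lambda * rho / 2) * expi theta)%C).
    assert (Hl' : 0 <= lambda * rho') by (apply Rmult_le_pos; lra).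
    assert (Hl : 0 <= lambda * rho) by (apply Rmult_le_pos; lra).
    assert (Hv : Cmod v = lambda * rho' / 2) by (apply Cmod_polar; lra).
    assert (Hz : (w + v)%C = z).
    { unfold w, v, z. rewrite (polar_complex _ _ _ _ x0_polar),
        (polar_complex _ _ _ _ Hp), (polar_complex _ _ _ _ Hpx).
      unfold Cplus, vsub. cbn [fst snd]. f_equal; field. }
    assert (Hvw : Cmod v < Cmod w).
    { rewrite Hv, Hw, Hrho0.
      apply Rmult_lt_compat_l with (r := lambda) in Hr'; lra. }
    assert (Hv0 : 0 <= Cmod v) by apply Cmod_ge_0.
    assert (Hgv : summable_at (power_coef a b) (Cmod w + Cmod v)) by (apply Hgrow; lra).
    assert (Hgz : summable_at (power_coef a b) (Cmod z)).
    { apply Hgrow. split; [apply Cmod_ge_0|]. rewrite <- Hz.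
      eapply Rle_lt_trans; [apply Cmod_triangle|]. lra. }
    destruct (asum_exists (fun x => power_coef a b x * mono z x)%C) as [s Hsz].
    { destruct Hgz as [M HM]. exists M. eapply sum_le_weaken; [|exact HM].
      intros y. rewrite Cmod_mult, Cmod_mono. apply Rle_refl. }
    assert (E : s = Psi x).
    { apply is_sum_Z_unique with (expansion_term lambda a b rho theta).
      - apply asum_is_sum_Z. now apply expansion_of_power_series.
      - apply HPsi; [exact Hxp|]. rewrite parent_center. unfold vsub. cbn [fst snd].
        destruct x as [x1 x2]. now rewrite !Rminus_0_r. }
    rewrite <- E. apply asum_is_sum_Z, expansion_of_power_series; [exact Hl'|].
    rewrite <- Hz in Hsz. destruct Hsz as [Hsz _].
    refine (asum_ext _ _ _ _ (recenter_expand _ w v Y s HY HgY Hgv Hsz)).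
    intros y. fold v. f_equal. now apply (recenter_power_coef lambda rho0 theta0 Y).
Qed.
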